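(* There is a unique $\lambda$-ring structure on $\mathrm{PS}_{\mathbb Z}$ whose Adams operations are $\psi_n(g)(x_{**})=g(x_{**}^n)$; with it and its grading by degree, $\mathrm{PS}_{\mathbb Z}$ is a graded $\lambda$-ring. For every special graded $\lambda$-ring $R=\bigoplus_{d\ge0}R_d$, the map $$\mathrm{Hom}_{\text{graded }\lambda\text{-rings}}(\mathrm{PS}_{\mathbb Z},R)\to\prod_{d\ge1}R_d,\qquad\phi\mapsto(\phi(M_d))_{d\ge1},$$ is a bijection, where $M_d=\sum_{j\ge1}x_{dj}$.
   Context: $\mathrm{PS}_{\mathbb Z}$ is the ring of formal sums, of bounded degree and integer coefficients, of monomials in indeterminates $x_{ij}$ ($i,j\ge1$, $x_{ij}$ of degree $i$) that are invariant under all permutations of $\mathbb N_{>0}^2$ preserving the first coordinate; $g(x_{**}^n)$ means substituting $x_{ij}\mapsto x_{ij}^n$. A $\lambda$-ring is a commutative ring with $\lambda_t:R\to1+tR[[t]]$, $\lambda_t(r)=1+rt+O(t^2)$, $\lambda_t(r+s)=\lambda_t(r)\lambda_t(s)$; Adams operations are defined by $\sum_{n\ge1}\psi_n(r)t^n=-t\frac{d}{dt}\log\sum_n\lambda_n(r)(-t)^n$. A $\lambda$-ring is special if $\lambda_t$ is a $\lambda$-ring homomorphism to $1+tR[[t]]$ with its canonical (big Witt vector) $\lambda$-structure. A graded $\lambda$-ring is a $\lambda$-ring $R=\bigoplus_{d\ge0}R_d$ graded as a ring with $\lambda_n(R_d)\subset R_{nd}$ for all $n,d$; morphisms are degree-preserving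 ring homomorphisms commuting with all $\lambda_n$. *)

(* Defs.v *)
From HB Require Import structures.
From mathcomp Require Import all_boot all_order all_algebra.
From mathcomp Require Import finmap mpoly.
Set Implicit Arguments. Unset Strict Implicit. Unset Printing Implicit Defensive.
Import Order.TTheory GRing.Theory Num.Theory.
Local Open Scope ring_scope.

(* Raw ring signatures.  PS_Z is handled as a set (predicate) of        *)
(* functions "monomial -> int" with explicitly defined operations, so   *)
(* all ring / lambda-ring notions below are stated for a carrier type   *)
(* with operations, relative to a predicate delimiting the carrier set. *)

Record rawRing := RawRing {
  rcar :> Type;
  radd : rcar -> rcar -> rcar;
  rmul : rcar -> rcar -> rcar;
  ropp : rcar -> rcar;
  rzero : rcar;
  rone : rcar }.

Section RawRing.
Variable A : rawRing.
Implicit Types (x y z : A) (P : A -> Prop).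

Definition rsum (s : seq nat) (F : nat -> A) : A :=
  foldr (fun i acc => radd (F i) acc) (rzero A) s.

Definition rnatmul (n : nat) x : A := iter n (radd x) (rzero A).

Definition rsign (k : nat) x : A := if odd k then ropp x else x.

Definition comm_ring_on P : Prop :=
  P (rzero A) /\ P (rone A) /\
  (forall x y, P x -> P y -> P (radd x y)) /\
  (forall x y, P x -> P y -> P (rmul x y)) /\
  (forall x, P x -> P (ropp x)) /\
  (forall x y z, P x -> P y -> P z -> radd x (radd y z) = radd (radd x y) z) /\
  (forall x y, P x -> P y -> radd x y = radd y x) /\
  (forall x, P x -> radd (rzero A) x = x) /\
  (forall x, P x -> radd (ropp x) x = rzero A) /\
  (forall x y z, P x -> P y -> P z -> rmul x (rmul y z) = rmul (rmul x y) z) /\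
  (forall x y, P x -> P y -> rmul x y = rmul y x) /\
  (forall x, P x -> rmul (rone A) x = x) /\
  (forall x y z, P x -> P y -> P z ->
     rmul x (radd y z) = radd (rmul x y) (rmul x z)).

(* lambda-ring structure lam on the commutative ring P:
   lambda_t(x) = sum_n lam n x t^n = 1 + x t + O(t^2),
   lambda_t(x + y) = lambda_t(x) lambda_t(y)  (coefficientwise). *)
Definition lambda_ring_on P (lam : nat -> A -> A) : Prop :=
  [/\ comm_ring_on P,
      forall n x, P x -> P (lam n x),
      forall x, P x -> lam 0%N x = rone A,
      forall x, P x -> lam 1%N x = x &
      forall n x y, P x -> P y ->
        lam n (radd x y) =
        rsum (iota 0 n.+1) (fun k => rmul (lam k x) (lam (n - k)%N y))].

(* psi is the family of Adams operations of lam: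
   sum_{n>=1} psi_n(x) t^n = -t d/dt log (sum_n lam_n(x) (-t)^n),
   written out coefficientwise (multiply by sum_n lam_n(x)(-t)^n):
   psi_n = (-1)^(n-1) n lam_n - sum_{k=1}^{n-1} (-1)^k lam_k psi_(n-k). *)
Definition adams_ops_are P (lam psi : nat -> A -> A) : Prop :=
  forall n x, (0 < n)%N -> P x ->
    psi n x =
    radd (rsign n.-1 (rnatmul n (lam n x)))
         (ropp (rsum (iota 1 n.-1)
                  (fun k => rsign k (rmul (lam k x) (psi (n - k)%N x))))).

Definition graded_ring_on P (G : nat -> A -> Prop) : Prop :=
  (forall d x, G d x -> P x) /\
  (forall d, G d (rzero A)) /\
  (forall d x y, G d x -> G d y -> G d (radd x y)) /\
  (forall d x, G d x -> G d (ropp x)) /\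
  G 0%N (rone A) /\
  (forall d e x y, G d x -> G e y -> G (d + e)%N (rmul x y)) /\
  (forall x, P x -> exists (N : nat) (c : nat -> A),
      (forall d, G d (c d)) /\ x = rsum (iota 0 N) c) /\
  (forall (N : nat) (c : nat -> A), (forall d, G d (c d)) ->
      rsum (iota 0 N) c = rzero A -> forall d, (d < N)%N -> c d = rzero A).

Definition graded_lambda_ring_on P (lam : nat -> A -> A)
    (G : nat -> A -> Prop) : Prop :=
  [/\ lambda_ring_on P lam, graded_ring_on P G &
      forall n d x, G d x -> G (n * d)%N (lam n x)].

End RawRing.

Definition ringRaw (R : comPzRingType) : rawRing :=
  @RawRing R (@GRing.add R) (@GRing.mul R) (@GRing.opp R) 0 1.

Definition esymf (R : comPzRingType) (I : finType) (k : nat) (F : I -> R) : R :=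
  \sum_(S : {set I} | #|S| == k) \prod_(i in S) F i.

Definition evalZ (R : comPzRingType) (k : nat) (v : 'I_k -> R)
    (p : {mpoly int[k]}) : R :=
  \sum_(m <- msupp p) (p@_m)%:~R * \prod_(i < k) v i ^+ m i.

(* P is the universal polynomial P_n(a_1..a_n; b_1..b_n) (variable i < n is
   a_(i+1), variable n + j is b_(j+1)) defined by
   P_n(e_1(x),..,e_n(x); e_1(y),..,e_n(y)) = e_n((x_i y_j)_(i,j))
   in Z[x_1..x_n, y_1..y_n]; it gives the product of big Witt vectors. *)
Definition is_Pn (n : nat) (P : {mpoly int[n + n]}) : Prop :=
  let x (i : 'I_n) : {mpoly int[n + n]} := 'X_(lshift n i) in
  let y (j : 'I_n) : {mpoly int[n + n]} := 'X_(rshift n j) in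
  evalZ (fun v : 'I_(n + n) => match split v with
                               | inl i => esymf i.+1 x
                               | inr j => esymf j.+1 y end) P
  = esymf n (fun ij : 'I_n * 'I_n => x ij.1 * y ij.2).

(* P is the universal polynomial P_{n,m}(a_1..a_(nm)) (variable i is a_(i+1))
   defined by P_{n,m}(e_1(x),..,e_(nm)(x)) =
   e_n((x_(i_1)...x_(i_m))_(i_1<...<i_m)) in Z[x_1..x_(nm)];
   it gives lambda^n of big Witt vectors. *)
Definition is_Pnm (n m : nat) (P : {mpoly int[n * m]}) : Prop :=
  let x (i : 'I_(n * m)) : {mpoly int[n * m]} := 'X_i in
  evalZ (fun v : 'I_(n * m) => esymf v.+1 x) P
  = esymf n (fun S : {S : {set 'I_(n * m)} | #|S| == m} =>
               \prod_(i in val S) x i).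

(* R is special: lambda_t : R -> 1 + tR[[t]] is a lambda-ring homomorphism
   for the big Witt vector lambda-ring structure (additivity is part of the
   lambda-ring axioms) *)
Definition special (R : comPzRingType) (lam : nat -> R -> R) : Prop :=
  [/\ (* lambda_t(1) = 1 + t *)
      forall n, (1 < n)%N -> lam n 1 = 0,
      (* lambda_t(r s) = lambda_t(r) * lambda_t(s) in the Witt ring *)
      forall n (P : {mpoly int[n + n]}) (r s : R), (0 < n)%N -> is_Pn P ->
        lam n (r * s) =
        evalZ (fun v : 'I_(n + n) => match split v with
                                     | inl i => lam i.+1 r
                                     | inr j => lam j.+1 s end) P &
      (* lambda_t(lam_m r) = lam_m^W(lambda_t(r)) *)
      forall n m (P : {mpoly int[n * m]}) (r : R), (0 < n)%N -> (0 < m)%N ->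
        is_Pnm P ->
        lam n (lam m r) = evalZ (fun v : 'I_(n * m) => lam v.+1 r) P].

(* Variables x_(i,j), i,j >= 1, are indexed by keys (i-1, j-1) : nat*nat;*)
(* x_(i,j) has degree i.  A monomial is a finitely supported exponent    *)
(* function; a formal sum is its coefficient function mono -> int.       *)

Definition mono := {fsfun nat * nat -> nat with 0%N}.

Definition mdeg (m : mono) : nat :=
  (\sum_(k <- finsupp m) m k * k.1.+1)%N.

Definition mbound (m : mono) : nat := (\max_(k <- finsupp m) m k)%N.

(* divisors of m are parametrised by exponent choices c on the support *)
Definition mono_of (m : mono) (c : {ffun finsupp m -> 'I_(mbound m).+1}) : mono :=
  [fsfun k : finsupp m => (c k : nat) | 0%N].
Definition mono_co (m : mono) (c : {ffun finsupp m -> 'I_(mbound m).+1}) : mono :=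
  [fsfun k : finsupp m => (m (val k) - c k)%N | 0%N].

Definition PSadd (f g : mono -> int) : mono -> int := fun m => f m + g m.
Definition PSopp (f : mono -> int) : mono -> int := fun m => - f m.
Definition PSzero : mono -> int := fun _ => 0.
Definition PSone : mono -> int := fun m => (finsupp m == fset0)%fset%:Z.
(* product of formal sums: coefficient of m is sum over m = a + b *)
Definition PSmul (f g : mono -> int) : mono -> int := fun m =>
  \sum_(c : {ffun finsupp m -> 'I_(mbound m).+1} |
          [forall k, (c k <= m (val k))%N])
     f (mono_of c) * g (mono_co c).

Definition PSraw : rawRing := @RawRing (mono -> int) PSadd PSmul PSopp PSzero PSone.

(* invariance under all permutations of N_{>0}^2 preserving the first
   coordinate (sigma sends x_k to x_(sigma k), hence m to m') *)
Definition row_invariant (f : mono -> int) : Prop :=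
  forall sigma : nat * nat -> nat * nat, bijective sigma ->
  (forall k, (sigma k).1 = k.1) ->
  forall m m' : mono, (forall k, m' (sigma k) = m k) -> f m' = f m.

Definition PS (f : mono -> int) : Prop :=
  (exists D : nat, forall m, (D < mdeg m)%N -> f m = 0) /\ row_invariant f.

Definition PSdeg (d : nat) (f : mono -> int) : Prop :=
  PS f /\ forall m, mdeg m <> d -> f m = 0.

(* psi_n(g)(x) = g(x^n), i.e. x_ij replaced by x_ij^n: coefficient of m is g(m/n) if n divides
   all exponents of m, and 0 otherwise *)
Definition mdivn (n : nat) (m : mono) : mono :=
  [fsfun k : finsupp m => (m (val k) %/ n)%N | 0%N].
Definition PSpsi (n : nat) (g : mono -> int) : mono -> int := fun m =>
  if [forall k : finsupp m, n %| m (val k)]%N then g (mdivn n m) else 0.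

(* M_d = sum_{j>=1} x_(d,j): coefficient 1 exactly on the monomials
   x_(d,j) = (single variable in row d, exponent 1) *)
Definition Md (d : nat) : mono -> int := fun m =>
  [exists k : finsupp m, [&& finsupp m == [fset val k]%fset, m (val k) == 1%N
                           & (val k).1 == d.-1]]%:Z.

Definition graded_lambda_hom (lam : nat -> PSraw -> PSraw)
    (R : comPzRingType) (lamR : nat -> R -> R) (GR : nat -> R -> Prop)
    (phi : (mono -> int) -> R) : Prop :=
  [/\ forall f g, PS f -> PS g -> phi (PSadd f g) = phi f + phi g,
      forall f g, PS f -> PS g -> phi (PSmul f g) = phi f * phi g,
      phi PSone = 1,
      forall n f, PS f -> phi (lam n f) = lamR n (phi f) &
      forall d f, PSdeg d f -> GR d (phi f)].

(* Main.v *)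
Require Import Defs.
From Stdlib Require Import FunctionalExtensionality ClassicalEpsilon.
From HB Require Import structures.
From mathcomp Require Import all_boot all_order all_algebra all_fingroup.
From mathcomp Require Import finmap ssrcomplements mpoly ring zify.
Set Implicit Arguments. Unset Strict Implicit. Unset Printing Implicit Defensive.
Import Order.TTheory GRing.Theory Num.Theory.
Local Open Scope ring_scope.

(** By row-symmetry, a formal sum of degree at most D is determined by its truncation to the
    variables x_ij with i, j <= N, for any N >= D; truncation is a ring homomorphism to
    Z[x_ij]_(i, j <= N) commuting with the psi_n.  In such a polynomial ring, Newton's recursion
    n lambda_n = +- sum_k (-1)^k lambda_k psi_(n-k) has an integral solution: for a monomial u
    (or -u) it is given by 1 + ut (or its inverse), and solutions multiply.  This yields the
    lambda-structure on PS_Z, unique because PS_Z has no torsion.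
    The polynomials symmetric in each row are the polynomials in the elementary symmetric
    functions lambda^n(M_d) of the rows, which are algebraically independent (comparison of
    leading monomials).  So a morphism phi is determined by the phi(M_d), and
    lambda^n(M_d) |-> lambda^n(r_d) defines a ring homomorphism.  The elements on which it
    commutes with all lambda^n are stable under sums and opposites; they contain the
    lambda^m(M_d) thanks to P_{n,m}, and, for sums of monomials, products thanks to P_n. *)

(** * Integer polynomials evaluated in a commutative ring *)

(** The ring R may have torsion, so commuting with the Adams operations would not give compatibility
    with the lambda-operations in R; this is why the universal polynomials enter. The identity for
    P_{n,m} applied to lambda^m(M_d) involves lambda^1(M_d), ..., lambda^(nm)(M_d), and with N
    variables per row only the first N of them are available as independent generators. So no single
    truncation serves all n: compatibility is proved for n up to a bound, at a level N chosen large
    enough, and values in R are attached to formal sums through all large levels at once. Products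
    need both factors to be sums of monomials, since only then does lambda_t split into factors 1 +
    ut to which P_n applies; general elements are integer combinations of such products. *)

Section EvalZ.
Variables (R : comPzRingType) (k : nat).
Implicit Types (v : 'I_k -> R) (p q : {mpoly int[k]}).

(** Summing over all monomials below a common bound, instead of the support of each polynomial,
    makes additivity and scaling termwise. *)
Lemma evalZw v p n : (msize p <= n)%N ->
  evalZ v p = \sum_(m : 'X_{1..k < n}) (p@_m)%:~R * \prod_(i < k) v i ^+ m i.
Proof.
move=> le; rewrite /evalZ (big_mksub 'X_{1..k < n}) /=; first last.
- by move=> x /msize_mdeg_lt /leq_trans; apply.
- exact: msupp_uniq.
rewrite big_rmcond //= => i /memN_msupp_eq0 ->.
by rewrite mulr0z mul0r.
Qed.

Lemma evalZ_is_additive v : zmod_morphism (evalZ v).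
Proof.
move=> p q; pose n := maxn (msize (p - q)) (maxn (msize p) (msize q)).
rewrite !(@evalZw _ _ n) ?leq_max ?leqnn ?orbT // -sumrB.
by apply: eq_bigr => m _; rewrite mcoeffB rmorphB /= mulrBl.
Qed.

HB.instance Definition _ v :=
  GRing.isZmodMorphism.Build {mpoly int[k]} R (evalZ v) (evalZ_is_additive v).

Lemma evalZXm v m : evalZ v 'X_[m] = \prod_(i < k) v i ^+ m i.
Proof. by rewrite /evalZ msuppX big_seq1 mcoeffX eqxx mul1r. Qed.

Lemma evalZZ v c p : evalZ v (c *: p) = c%:~R * evalZ v p.
Proof.
pose n := maxn (msize (c *: p)) (msize p).
rewrite !(@evalZw _ _ n) ?leq_max ?leqnn ?orbT // big_distrr.
by apply: eq_bigr => m _; rewrite mcoeffZ rmorphM /= mulrA.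
Qed.

Lemma evalZ_is_multiplicative v : monoid_morphism (evalZ v).
Proof.
split=> [|p q].
  by rewrite -mpolyX0 evalZXm big1 // => i _; rewrite mnm0E expr0.
rewrite (mpolyE p) (mpolyE q) big_distrlr /= !raddf_sum /=.
rewrite [RHS]big_distrl /=; apply: eq_bigr => a _.
rewrite raddf_sum /= big_distrr /=; apply: eq_bigr => b _.
rewrite -scalerAl -scalerAr -mpolyXD !evalZZ !evalZXm mulrACA mulrA; congr (_ * _).
by rewrite -big_split; apply: eq_bigr => i _; rewrite mnmDE exprD.
Qed.

HB.instance Definition _ v :=
  GRing.isMonoidMorphism.Build {mpoly int[k]} R (evalZ v) (evalZ_is_multiplicative v).

Lemma evalZX v i : evalZ v 'X_i = v i.
Proof.
rewrite evalZXm (bigD1 i) //= mnm1E eqxx expr1 big1 ?mulr1 // => j ne.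
by rewrite mnm1E eq_sym (negbTE ne).
Qed.

Lemma eq_evalZ v w p : v =1 w -> evalZ v p = evalZ w p.
Proof.
by move=> e; apply: eq_bigr => m _; congr (_ * _); apply: eq_bigr => i _; rewrite e.
Qed.

Lemma evalZE v p :
  evalZ v p = \sum_(m <- msupp p) (p@_m)%:~R * evalZ v 'X_[m].
Proof. by apply: eq_bigr => m _; rewrite evalZXm. Qed.

End EvalZ.

Lemma rmorph_evalZ (R S : comPzRingType) (f : {rmorphism R -> S}) k
    (v : 'I_k -> R) (p : {mpoly int[k]}) :
  f (evalZ v p) = evalZ (fun i => f (v i)) p.
Proof.
rewrite /evalZ rmorph_sum; apply: eq_bigr => m _.
rewrite rmorphM rmorph_int rmorph_prod; congr (_ * _).
by apply: eq_bigr => i _; rewrite rmorphXn.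
Qed.

Lemma evalZ_comp (R : comPzRingType) k l (v : 'I_l -> R)
    (w : 'I_k -> {mpoly int[l]}) (p : {mpoly int[k]}) :
  evalZ v (evalZ w p) = evalZ (fun i => evalZ v (w i)) p.
Proof. exact: (rmorph_evalZ (evalZ v)). Qed.

(** * Elementary symmetric functions as coefficients of a generating product *)

Section Gen.
Variables (A : comNzRingType).

(** The generating product is the convenient form: it splits along a partition of the variables,
    ignores variables equal to 0 and commutes with morphisms. *)
Lemma gen_coef (I : finType) (P : pred I) (x : I -> A) k :
  (\prod_(i | P i) (1 + x i *: 'X))`_k
  = \sum_(S : {set I} | (S \subset P) && (#|S| == k)) \prod_(i in S) x i.
Proof.
(* With [F] zero outside [P], the expansion can run over all subsets; those not contained in [P]
   contribute 0. *)
pose F i : {poly A} := if P i then x i *: 'X else 0.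
have -> : \prod_(i | P i) (1 + x i *: 'X) = \prod_i (F i + 1).
  rewrite big_mkcond; apply: eq_bigr => i _; rewrite /F addrC.
  by case: (P i); rewrite // add0r.
rewrite bigA_distr coef_sum [RHS]big_mkcond; apply: eq_bigr => S _.
rewrite -big_mkcond /=; case: (boolP (S \subset P)) => [/subsetP sP|/subsetPn[i iS niP]] /=.
  rewrite (eq_bigr (fun i => (x i)%:P * 'X)); last first.
    by move=> i /sP; rewrite /F unfold_in => ->; rewrite mul_polyC.
  rewrite big_split /= prodr_const -rmorph_prod mul_polyC coefZ coefXn eq_sym.
  by case: eqP => _; rewrite ?mulr1 ?mulr0.
by rewrite (bigD1 i) //= /F; move: niP; rewrite unfold_in => /negbTE->; rewrite mul0r coef0.
Qed.

Lemma esymfE (I : finType) k (x : I -> A) :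
  esymf k x = (\prod_i (1 + x i *: 'X))`_k.
Proof.
rewrite gen_coef; apply: eq_bigl => S.
by rewrite (_ : S \subset _) //; apply/subsetP.
Qed.

End Gen.

Lemma eq_gen (A : comNzRingType) (I : finType) (P Q : pred I) (x y : I -> A) k :
  P =1 Q -> (forall i, P i -> x i = y i) ->
  (\prod_(i | P i) (1 + x i *: 'X))`_k = (\prod_(i | Q i) (1 + y i *: 'X))`_k.
Proof. by move=> eP e; congr ((polyseq _)`_ _); apply: eq_big => // i /e ->. Qed.

Lemma rmorph_gen (A B : comNzRingType) (f : {rmorphism A -> B}) (I : finType)
  (P : pred I) (x : I -> A) k :
  f (\prod_(i | P i) (1 + x i *: 'X))`_k = (\prod_(i | P i) (1 + f (x i) *: 'X))`_k.
Proof.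
rewrite -coef_map rmorph_prod /=; congr ((polyseq _)`_ _).
have e i : map_poly f (1 + x i *: 'X) = 1 + f (x i) *: 'X.
  by rewrite rmorphD rmorph1 /= map_polyZ map_polyX.
by rewrite (eq_bigr _ (fun i _ => e i)).
Qed.

(** * Polynomials symmetric in each row of variables *)

Section Homogeneous.
Variables (K : nat) (w : 'I_K -> nat).
Implicit Types (m : 'X_{1..K}) (p q : {mpoly int[K]}).

Definition wt m := (\sum_(i < K) w i * m i)%N.

Definition whomog d p := forall m, m \in msupp p -> wt m = d.

Lemma wt0 : wt 0%MM = 0%N.
Proof. by apply: big1 => i _; rewrite mnm0E muln0. Qed.

Lemma wtD m m' : wt (m + m')%MM = (wt m + wt m')%N.
Proof.
by rewrite /wt -big_split; apply: eq_bigr => i _; rewrite mnmDE mulnDr.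
Qed.

Lemma wtU i : wt U_(i)%MM = w i.
Proof.
rewrite /wt (bigD1 i) //= mnm1E eqxx muln1 big1 ?addn0 // => j ne.
by rewrite mnm1E eq_sym (negbTE ne) muln0.
Qed.

Lemma whomogM d e p q : whomog d p -> whomog e q -> whomog (d + e) (p * q).
Proof.
move=> hp hq m /msuppM_le /allpairsP[[a b] /= [/hp <- /hq <- ->]].
exact: wtD.
Qed.

Lemma whomogX m : whomog (wt m) 'X_[m].
Proof. by move=> m'; rewrite msuppX inE => /eqP->. Qed.

Lemma whomogU i : whomog (w i) 'X_i.
Proof. by rewrite -wtU; apply: whomogX. Qed.

Lemma whomog1 : whomog 0 1.
Proof. by rewrite -mpolyX0 -wt0; apply: whomogX. Qed.

Lemma whomogXn d p n : whomog d p -> whomog (d * n) (p ^+ n).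
Proof.
move=> hp; elim: n => [|n IH]; first by rewrite muln0; apply: whomog1.
by rewrite exprS mulnS; apply: whomogM.
Qed.

Lemma whomog_prod (I : Type) (s : seq I) (P : pred I) (d : I -> nat) F :
  (forall i, P i -> whomog (d i) (F i)) ->
  whomog (\sum_(i <- s | P i) d i) (\prod_(i <- s | P i) F i).
Proof.
move=> h; elim/big_rec2: _ => [|i e p Pi IH]; first exact: whomog1.
exact: whomogM (h _ Pi) IH.
Qed.

Lemma whomog_sum (I : Type) (s : seq I) (P : pred I) d F :
  (forall i, P i -> whomog d (F i)) -> whomog d (\sum_(i <- s | P i) F i).
Proof.
move=> h; elim/big_rec: _ => [|i p Pi IH m]; first by move=> m; rewrite msupp0.
by move/msuppD_le; rewrite mem_cat => /orP[/(h _ Pi)|/IH].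
Qed.

Lemma whomog_gen (I : finType) (P : pred I) (F : I -> {mpoly int[K]}) d k :
  (forall i, P i -> whomog d (F i)) ->
  whomog (d * k) (\prod_(i | P i) (1 + F i *: 'X))`_k.
Proof.
move=> h; rewrite gen_coef; apply: whomog_sum => S /andP[/subsetP sP /eqP <-].
by rewrite mulnC -sum_nat_const; apply: whomog_prod => i /sP; apply: h.
Qed.

End Homogeneous.

Lemma mcoeff_intM K (c : int) (p : {mpoly int[K]}) m : (c%:~R * p)@_m = c * p@_m.
Proof. by rewrite mulrzl raddfMz /= -mulrzl intz. Qed.

Lemma mcoeff_evalZ K l (v : 'I_l -> {mpoly int[K]}) (p : {mpoly int[l]}) m :
  (evalZ v p)@_m = \sum_(a <- msupp p) p@_a * (evalZ v 'X_[a])@_m.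
Proof.
rewrite evalZE (raddf_sum (mcoeff m)).
by apply: eq_bigr => a _; apply: mcoeff_intM.
Qed.

Section Rows.
Variables (K : nat) (row rank : 'I_K -> nat).
(** Together the two hypotheses make [rank] number each row 0, 1, ... without gaps, in the order of
    the variables seen by the monomial order. *)
Hypothesis rank_mono : forall k k', row k = row k' -> (rank k < rank k')%N = (k < k')%N.
Hypothesis rank_sat : forall k j, (j < rank k)%N ->
  exists k', row k' = row k /\ rank k' = j.
Implicit Types (m a : 'X_{1..K}) (p q F : {mpoly int[K]}).

Lemma rank_inj k k' : row k = row k' -> rank k = rank k' -> k = k'.
Proof.
move=> er e; apply: val_inj; case: (ltngtP k k') => //.
  by rewrite -(rank_mono er) e ltnn.
by rewrite -(rank_mono (esym er)) e ltnn.
Qed.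

(* The variables of row [d] are listed by [rank = 0, 1, ...], so that [row_esym] sends the
   variable of rank [j] to the elementary symmetric polynomial of degree [j + 1] of its row. *)
Definition row_esym k : {mpoly int[K]} :=
  (\prod_(i | row i == row k) (1 + 'X_i *: 'X))`_(rank k).+1.

Definition is_eterm k m :=
  (mdeg m == (rank k).+1) && [forall i, (m i <= (row i == row k))%N].

(** Distinct subsets of a row give distinct squarefree monomials, so nothing accumulates and every
    coefficient is 0 or 1. *)
Lemma mcoeff_row_esym k m : (row_esym k)@_m = (is_eterm k m)%:R.
Proof.
rewrite /row_esym gen_coef raddf_sum /=.
under eq_bigr => S _ do rewrite mprodXE mcoeffX.
have mE (S : {set 'I_K}) i : (\sum_(j in S) U_(j))%MM i = (i \in S) :> nat.
  rewrite mnm_sumE; case: (boolP (i \in S)) => iS.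
    rewrite (bigD1 i) //= mnm1E eqxx big1 // => j /andP[_ ne].
    by rewrite mnm1E (negbTE ne).
  rewrite big1 // => j jS; rewrite mnm1E.
  by case: eqP => // e; rewrite -e jS in iS.
have dE (S : {set 'I_K}) : mdeg (\sum_(j in S) U_(j))%MM = #|S|.
  by rewrite mdeg_sum -sum1_card; apply: eq_bigr => i _; rewrite mdeg1.
case: (boolP (is_eterm k m)) => [/andP[/eqP dm /forallP hm]|nm].
  pose S := [set i | m i == 1%N].
  have Sm : (\sum_(j in S) U_(j))%MM = m.
    apply/mnmP => i; rewrite mE inE; have := hm i.
    by case: (row i == row k); case: (m i) => [|[|]].
  rewrite (bigD1 S) /=; last first.
    rewrite -dE Sm dm eqxx andbT; apply/subsetP => i; rewrite inE => /eqP mi.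
    by have := hm i; rewrite mi unfold_in; case: eqP.
  rewrite Sm eqxx big1 ?addr0 // => T /andP[_ ne].
  case: eqP => // e; case/eqP: ne; apply/setP => i; rewrite inE -e mE.
  by case: (i \in T).
rewrite big1 // => S /andP[/subsetP sS /eqP cS].
case: eqP => // e; case/negP: nm; rewrite /is_eterm -e dE cS eqxx /=.
apply/forallP => i; rewrite mE; case: (boolP (i \in S)) => // /sS.
by rewrite unfold_in => ->.
Qed.

Definition elead k := [multinom ((row i == row k) && (rank i <= rank k)%N : nat) | i < K].

(** By [rank_sat] and [rank_inj] the row has exactly one variable of each rank up to [rank k]; [f]
    lists them. *)
Lemma mdeg_elead k : mdeg (elead k) = (rank k).+1.
Proof.
have ex (j : 'I_(rank k).+1) : exists i, row i = row k /\ rank i = j.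
  have := ltn_ord j; rewrite ltnS leq_eqVlt => /predU1P[->|/rank_sat] //.
  by exists k.
have [f hf] := fin_all_exists ex.
have f_inj : injective f.
  by move=> i j e; apply: val_inj; rewrite /= -(hf i).2 e (hf j).2.
rewrite mdegE; under eq_bigr => i _ do rewrite mnmE.
rewrite -[RHS]card_ord -(card_imset _ f_inj) -sum1_card [RHS]big_mkcond.
apply: eq_bigr => i _; case: imsetP => [[j _ ->]|ni].
  by have [-> ->] := hf j; rewrite eqxx -ltnS ltn_ord.
case: andP => // -[/eqP er le]; case: ni; exists (inord (rank i)) => //.
have [er' e'] := hf (inord (rank i)).
by apply: rank_inj; rewrite ?er' ?e' // inordK.
Qed.

Lemma is_eterm_elead k : is_eterm k (elead k).
Proof.
rewrite /is_eterm mdeg_elead eqxx; apply/forallP => i; rewrite mnmE.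
by case: (row i == row k) => //=; apply: leq_b1.
Qed.

(** Look at the first variable [i] where the exponents differ. If [m] had the larger one, [i] would
    come after all the variables of [elead k], so [m] would be divisible by [elead k] times that
    variable, which has too large a degree. *)
Lemma is_eterm_le k m : is_eterm k m -> (m <= elead k)%O.
Proof.
move=> hm; have [dm hi] := andP hm; move/eqP: dm => dm; move/forallP: hi => hi.
case: (eqVneq m (elead k)) => [->//|ne]; apply: ltW.
have [i0 ni0] : exists i, m i != elead k i.
  apply/existsP; apply: contraNT ne => /existsPn h.
  by apply/eqP/mnmP => i; have := h i; rewrite negbK => /eqP.
apply/ltmcP; first by rewrite dm mdeg_elead.
have [i ni imin] := @arg_minnP _ i0 (fun i => m i != elead k i) val ni0.
exists i => [j ltj|].
  by apply/eqP; apply: contraTT ltj => /imin; rewrite -leqNgt.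
rewrite ltn_neqAle ni leqNgt; apply/negP => lt.
have [mi ei] : (m i = 1 /\ elead k i = 0)%N.
  have := leq_trans lt (hi i); have := hi i; case: (row i == row k) => //=.
  by case: (m i) lt => [|[|]] //; case: (elead k i).
have ri : row i = row k by apply/eqP; have := hi i; rewrite mi; case: (_ == _).
have rki : (rank k < rank i)%N.
  by move: ei; rewrite mnmE ri eqxx /= ltnNge; case: (_ <= _)%N.
suff /mnm_lepP le : (elead k + U_(i) <= m)%MM.
  have : (mdeg (elead k + U_(i))%MM <= mdeg m)%N.
    by rewrite !mdegE; apply: leq_sum => j _; apply: le.
  by rewrite mdegD mdeg1 mdeg_elead dm addn1 ltnn.
apply/mnm_lepP => j; rewrite mnmDE mnm1E.
case: eqP => [<-|_]; first by rewrite ei mi.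
rewrite addn0; case: (ltnP j i) => ji.
  by apply/eq_leq/esym/eqP; apply: contraTT ji => /imin; rewrite -leqNgt.
rewrite mnmE; case: eqP => //= rj; case: (leqP (rank j) (rank k)) => // lejk.
suff : (j < i)%N by rewrite ltnNge ji.
by rewrite -rank_mono ?rj ?ri //; apply: leq_ltn_trans rki.
Qed.

Lemma row_esym_neq0 k : row_esym k != 0.
Proof.
apply/eqP => /(congr1 (mcoeff (elead k))).
by rewrite mcoeff_row_esym is_eterm_elead mcoeff0.
Qed.

Lemma mlead_row_esym k : mlead (row_esym k) = elead k.
Proof.
apply: le_anti; rewrite [X in _ && X]msupp_le_mlead ?andbT.
  apply: is_eterm_le; have := mlead_supp (row_esym_neq0 k).
  by rewrite mcoeff_msupp mcoeff_row_esym; case: is_eterm.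
by rewrite mcoeff_msupp mcoeff_row_esym is_eterm_elead.
Qed.

Lemma mleadc_row_esym k : (row_esym k)@_(elead k) = 1.
Proof. by rewrite mcoeff_row_esym is_eterm_elead. Qed.

(* The exponent of the leading monomial of [prod_k (row_esym k)^(a k)]. *)
Definition elead_exp a := (\sum_(k < K) elead k *+ a k)%MM.

Lemma lreg_row_esym k : GRing.lreg (row_esym k)@_(mlead (row_esym k)).
Proof. by rewrite mlead_row_esym mleadc_row_esym; apply: lreg1. Qed.

Lemma mlead_emonom a : mlead (evalZ row_esym 'X_[a]) = elead_exp a.
Proof.
rewrite evalZXm mlead_prod_proper => [|k _ _]; last first.
  by rewrite mleadcX_proper; [apply: lregX|]; apply: lreg_row_esym.
apply: eq_bigr => k _.
by rewrite mleadX_proper; [rewrite mlead_row_esym | apply: lreg_row_esym].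
Qed.

Lemma mleadc_emonom a : (evalZ row_esym 'X_[a])@_(elead_exp a) = 1.
Proof.
rewrite -mlead_emonom evalZXm mleadc_prod_proper => [|k _ _].
  rewrite big1 // => k _; rewrite mleadcX_proper; last exact: lreg_row_esym.
  by rewrite mlead_row_esym mleadc_row_esym expr1n.
by rewrite mleadcX_proper; [apply: lregX|]; apply: lreg_row_esym.
Qed.

Lemma elead_expE a i :
  elead_exp a i = (\sum_(k | (row i == row k) && (rank i <= rank k)%N) a k)%N.
Proof.
rewrite mnm_sumE [RHS]big_mkcond; apply: eq_bigr => k _.
by rewrite mulmnE mnmE; case: andP; rewrite ?mul1n ?mul0n.
Qed.

Lemma elead_expD1 a i : elead_exp a i =
  (a i + \sum_(k | ((row i == row k) && (rank i <= rank k)) && (k != i)) a k)%N.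
Proof. by rewrite elead_expE (bigD1 i) // eqxx leqnn. Qed.

(** The exponent at [i] is [a i] plus the [a k] of higher rank in the row, a triangular system: at a
    difference of maximal rank all the other terms agree. *)
Lemma elead_exp_inj : injective elead_exp.
Proof.
move=> a b e; apply/mnmP => k; apply/eqP; apply/negP => /negP nk.
have [{nk}k nk kmax] := @arg_maxnP _ k (fun k => a k != b k) rank nk.
case/eqP: nk; have := congr1 (fun m : 'X_{1..K} => m k) e.
rewrite /= !elead_expD1 (eq_bigr b); first exact: addIn.
move=> j /andP[/andP[/eqP rj lj] ne]; apply/eqP; apply: contraNT ne => /kmax lj'.
apply/eqP/rank_inj => //; apply/anti_leq/andP; split=> //; exact: lj'.
Qed.

(** The exponents along a row form a partition; [a] consists of its successive differences. *)
Lemma elead_exp_surj m :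
  (forall i j, row i = row j -> (i <= j)%N -> (m j <= m i)%N) ->
  exists a, elead_exp a = m.
Proof.
move=> hm.
(* The exponent of the next variable in the row: the sum has at most one term, and is 0 at the end
   of the row. *)
pose nxt i := (\sum_(k | (row k == row i) && (rank k == (rank i).+1)) m k)%N.
pose a := [multinom (m i - nxt i)%N | i < K]; exists a; apply/mnmP => i.
(* Induction on the distance from [rank i] to the largest rank, that is, from the ends of the rows
   backwards. *)
move: {2}(\max_k rank k - rank i)%N (leqnn (\max_k rank k - rank i)) => n.
elim: n i => [|n IH] i hn.
  have hi k : row i = row k -> (rank i <= rank k)%N -> k = i.
    move=> rk le; apply: rank_inj => //; apply/eqP; rewrite eqn_leq le andbT.
    by move: hn; rewrite leqn0 subn_eq0; apply: leq_trans; apply: leq_bigmax.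
  rewrite elead_expE (big_pred1 i) => [|k].
    rewrite mnmE /nxt big_pred0 ?subn0 // => k; apply/negP => /andP[/eqP rk /eqP h].
    by have := hi k (esym rk); rewrite h leqnSn => /(_ isT) e; rewrite e in h;
       move/eqP: h; rewrite ltn_eqF.
  by apply/andP/eqP => [[/eqP rk /(hi _ rk)]|->].
rewrite elead_expD1.
case: (pickP (fun k => (row k == row i) && (rank k == (rank i).+1))) => [k /andP[/eqP rk /eqP ek]|no].
  have nE : nxt i = m k.
    rewrite /nxt (big_pred1 k) // => j; apply/andP/eqP => [[/eqP rj /eqP ej]|->].
      by apply: rank_inj; rewrite ?rj ?ej.
    by rewrite rk ek !eqxx.
  rewrite mnmE nE; under eq_bigl => j.
    rewrite (_ : _ && _ = (row k == row j) && (rank k <= rank j)%N); last first.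
      rewrite -andbA rk; case: eqP => //= rij; rewrite ek [RHS]ltn_neqAle andbC.
      congr (_ && _); apply/idP/idP; apply: contra => /eqP.
        by move=> e; apply/eqP/rank_inj.
      by move=> ->.
  over.
  rewrite -elead_expE IH; last first.
    by rewrite ek subnS; case: (_ - _)%N hn.
  apply: subnK; apply: hm => //; apply: ltnW; rewrite -rank_mono ?rk // ek.
  exact: ltnSn.
rewrite mnmE /nxt big_pred0 // subn0 big_pred0 ?addn0 // => k.
apply/negP => /andP[/andP[/eqP rk le] ne].
have lt : (rank i < rank k)%N.
  rewrite ltn_neqAle le andbT; apply: contra ne => /eqP e.
  by apply/eqP/rank_inj.
have [k' [rk' ek']] : exists k', row k' = row k /\ rank k' = (rank i).+1.
  move: lt; rewrite leq_eqVlt => /predU1P[->|/rank_sat //]; by exists k.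
by have := no k'; rewrite rk' rk ek' !eqxx.
Qed.

Lemma wt_elead_exp w a : (forall i j, row i = row j -> w i = w j) ->
  wt w (elead_exp a) = wt (fun k => w k * (rank k).+1)%N a.
Proof.
move=> hw; rewrite /wt; under eq_bigr => i _ do rewrite mnm_sumE big_distrr.
rewrite exchange_big; apply: eq_bigr => k _ /=.
rewrite -mdeg_elead mdegE big_distrr big_distrl; apply: eq_bigr => i _.
rewrite mulmnE mnmE mulnA; case: eqP => [/hw ->//|].
by rewrite /= !muln0.
Qed.

Lemma whomog_emonom w a : (forall i j, row i = row j -> w i = w j) ->
  whomog w (wt (fun k => w k * (rank k).+1)%N a) (evalZ row_esym 'X_[a]).
Proof.
move=> hw; rewrite evalZXm /wt; apply: whomog_prod => k _.
by apply: whomogXn; apply: whomog_gen => i /eqP /hw <-; apply: whomogU.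
Qed.

(** * The fundamental theorem on symmetric polynomials, row by row *)

Definition row_sym p :=
  forall s : 'S_K, (forall k, row (s k) = row k) -> msym s p = p.

Lemma msymU (s : 'S_K) i : msym s 'X_i = 'X_(s i) :> {mpoly int[K]}.
Proof.
rewrite msymX; congr 'X_[_]; apply/mnmP => j; rewrite mnmE !mnm1E.
by rewrite -(inj_eq (@perm_inj _ s)) permKV.
Qed.

Lemma row_sym_row_esym k : row_sym (row_esym k).
Proof.
move=> s hs; apply/mpolyP => m; rewrite mcoeff_sym !mcoeff_row_esym.
rewrite /is_eterm mdeg_mperm; do 2 congr (_ _); congr (_ && _).
apply/forallP/forallP => h i.
  by have := h ((s^-1)%g i); rewrite mnmE permKV -(hs (s^-1 i)%g) permKV.
by rewrite mnmE -(hs i).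
Qed.

Lemma row_sym_evalZ F : row_sym (evalZ row_esym F).
Proof.
move=> s hs; rewrite (rmorph_evalZ (msym s)); apply: eq_evalZ => k.
exact: row_sym_row_esym.
Qed.

(** Otherwise exchanging the two variables in the leading monomial would give a larger monomial of
    the support. *)
Lemma mlead_row_sym p i j : row_sym p -> row i = row j -> (i <= j)%N ->
  (mlead p j <= mlead p i)%N.
Proof.
move=> sp rij le_ij; have [->|nz_p] := eqVneq p 0.
  by rewrite mlead0 !mnm0E.
set m := mlead p; case: leqP => // h.
pose s := tperm i j; pose ms := [multinom m (s k) | k < K].
have lt : (m < ms)%O.
  apply/ltmcP; first by rewrite mdeg_mperm.
  exists i => [k lt_ki|]; last by rewrite mnmE tpermL.
  rewrite mnmE tpermD // neq_ltn orbC ?lt_ki //.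
  by rewrite (leq_trans lt_ki).
have : ms \in msupp p.
  rewrite mcoeff_msupp -mcoeff_sym sp ?mleadc_eq0 // => k.
  by rewrite /s; case: tpermP => // ->.
by move/msupp_le_mlead; rewrite leNgt lt.
Qed.

(** By [elead_exp_inj] the monomials of [F] have distinct leading monomials after evaluation, so the
    largest of these cannot cancel. *)
Lemma evalZ_row_esym_inj : injective (evalZ row_esym).
Proof.
suff h F : evalZ row_esym F = 0 -> F = 0.
  by move=> F G e; apply/eqP; rewrite -subr_eq0; apply/eqP/h; rewrite rmorphB /= e subrr.
move=> e0; apply/eqP; apply: contraT => nz.
have : exists2 a, a \in msupp F & forall b, b \in msupp F -> (elead_exp b <= elead_exp a)%O.
  move: nz; rewrite -msupp_eq0; elim: (msupp F) => // a s IH _.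
  case: (eqVneq s [::]) => [->|/IH [b bs hb]].
    by exists a; rewrite ?mem_head // => b; rewrite inE => /eqP ->.
  case: (leP (elead_exp a) (elead_exp b)) => [le|/ltW le].
    by exists b => [|c]; rewrite inE ?bs ?orbT // => /predU1P[->|/hb].
  exists a; rewrite ?mem_head // => c; rewrite inE => /predU1P[->//|/hb].
  by move/le_trans; apply.
case=> a aF amax; move: (aF); rewrite mcoeff_msupp.
pose c b := (evalZ row_esym 'X_[b])@_(elead_exp a).
have ca : c a = 1 := mleadc_emonom a.
have cb b : b \in msupp F -> b != a -> c b = 0.
  move=> /amax le ne; apply: mcoeff_gt_mlead.
  by rewrite mlead_emonom lt_neqAle le andbT (inj_eq elead_exp_inj).
have : \sum_(b <- msupp F) F@_b * c b = 0.
  by rewrite -mcoeff_evalZ e0 mcoeff0.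
move: c ca cb => c ca cb; rewrite (bigD1_seq a aF (msupp_uniq F)) /= ca mulr1.
rewrite big_seq_cond big1 => [|b /andP[bF ne]]; last by rewrite cb ?mulr0.
by rewrite addr0 => ->; rewrite eqxx.
Qed.

(** The leading monomial drops after subtracting a multiple of the product of elementary symmetric
    polynomials that shares it. [F] is chosen before [w] and [Q], so that the same [F] inherits
    degree bounds, homogeneity and the degree in a single row. *)
Lemma row_sym_evalZ_ex p : row_sym p ->
  exists F, evalZ row_esym F = p /\
    forall (w : 'I_K -> nat) (Q : nat -> Prop),
      (forall i j, row i = row j -> w i = w j) ->
      (forall m, m \in msupp p -> Q (wt w m)) ->
      forall a, a \in msupp F -> Q (wt (fun k => w k * (rank k).+1)%N a).
Proof.
elim/mleadrect: p => p IH sp; have [->|nz_p] := eqVneq p 0.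
  by exists 0; split=> [|w Q _ _ a]; [apply: raddf0 | rewrite msupp0].
have [a la] := elead_exp_surj (fun i j => @mlead_row_sym p i j sp).
have [e [eE le e1 se he]] : exists e, [/\ evalZ row_esym 'X_[a] = e,
    mlead e = mlead p, e@_(mlead p) = 1, row_sym e &
    forall w : 'I_K -> nat, (forall i j, row i = row j -> w i = w j) ->
      whomog w (wt (fun k => w k * (rank k).+1)%N a) e].
  exists (evalZ row_esym 'X_[a]); rewrite -la; split=> //.
  - exact: mlead_emonom.
  - exact: mleadc_emonom.
  - exact: row_sym_evalZ.
  - by move=> w; apply: whomog_emonom.
pose c := p@_(mlead p); pose q := p - c *: e.
have q0 : q@_(mlead p) = 0 by rewrite mcoeffB mcoeffZ e1 mulr1 subrr.
have leq : (mlead q <= mlead p)%O.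
  by apply: le_trans (mleadB_le _ _) _; rewrite mleadZ ?mleadc_eq0 // le joinxx.
have sq : row_sym q by move=> s hs; rewrite msymB msymZ sp // se.
have [F [eF hF]] : exists F, evalZ row_esym F = q /\
    forall (w : 'I_K -> nat) (Q : nat -> Prop),
      (forall i j, row i = row j -> w i = w j) ->
      (forall m, m \in msupp q -> Q (wt w m)) ->
      forall a, a \in msupp F -> Q (wt (fun k => w k * (rank k).+1)%N a).
  (* The case [q = 0] is apart because for constant [p] the leading monomial does not drop. *)
  have [q00|nz_q] := eqVneq q 0.
    exists 0; rewrite q00; split=> [|w Q _ _ b]; [apply: raddf0 | by rewrite msupp0].
  apply: IH => //; rewrite lt_neqAle leq andbT; apply: contra nz_q => /eqP e'.
  by rewrite -mleadc_eq0 e' q0.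
exists (F + c *: 'X_[a]); split=> [|w Q hw hQ b].
  by rewrite rmorphD /= evalZZ eE eF /q mulrzl -scaler_int intz subrK.
have Qa : Q (wt (fun k => w k * (rank k).+1)%N a).
  by rewrite -wt_elead_exp // la; apply/hQ/mlead_supp.
move/msuppD_le; rewrite mem_cat => /orP[|/msuppZ_le]; last first.
  by rewrite msuppX inE => /eqP->.
apply: hF => // m /msuppB_le; rewrite mem_cat => /orP[/hQ //|/msuppZ_le].
by move/(he _ hw) => ->.
Qed.

End Rows.

(** * Newton's identities *)

Section Newton.
Variable A : comNzRingType.
Implicit Types (L P : nat -> A) (p q : {poly A}).

(* Coefficientwise form of [P(t) L(-t) = - t d/dt L(-t)]. *)
Definition newton L P := L 0%N = 1 /\ forall n, (0 < n)%N ->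
  \sum_(k < n) (-1) ^+ k * (L k * P (n - k)%N) = (-1) ^+ n.-1 * (L n *+ n).

Definition conv L L' n := \sum_(k < n.+1) L k * L' (n - k)%N.

(** Identities of power series are stated modulo t^(n+1), on polynomials: [lowz n p] says that
    t^(n+1) divides [p], while [alt] and [psp] truncate L(-t) and P(t), the latter with constant
    term set to 0. *)
Let lowz n p := forall i, (i <= n)%N -> p`_i = 0.
Let alt L n : {poly A} := \poly_(k < n.+1) ((-1) ^+ k * L k).
Let psp P n : {poly A} := \poly_(k < n.+1) (if k == 0%N then 0 else P k).

Let lowzD n p q : lowz n p -> lowz n q -> lowz n (p + q).
Proof. by move=> hp hq i le; rewrite coefD hp ?hq ?addr0. Qed.

Let lowzB n p q : lowz n p -> lowz n q -> lowz n (p - q).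
Proof. by move=> hp hq i le; rewrite coefB hp ?hq ?subrr. Qed.

Let lowzM n p q : lowz n q -> lowz n (p * q).
Proof.
move=> hq i le; rewrite coefM big1 // => j _.
by rewrite hq ?mulr0 // (leq_trans (leq_subr _ _)).
Qed.

Let lowzXd n p : lowz n p -> lowz n ('X * p^`()).
Proof.
move=> hp [|i] le; rewrite coefXM //= coef_deriv hp ?mul0rn //.
Qed.

Let altE L n i : (i <= n)%N -> (alt L n)`_i = (-1) ^+ i * L i.
Proof. by move=> le; rewrite coef_poly ltnS le. Qed.

Let newton_coef L P n i : (i < n)%N ->
  (alt L n * psp P n + 'X * (alt L n)^`())`_i.+1 =
  \sum_(k < i.+1) (-1) ^+ k * (L k * P (i.+1 - k)%N) - (-1) ^+ i * (L i.+1 *+ i.+1).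
Proof.
move=> le; rewrite coefD coefXM /= coef_deriv altE //; congr (_ + _); last first.
  by rewrite exprS mulN1r mulNr mulNrn mulrnAr.
rewrite coefM big_ord_recr /= subnn [X in _ * X]coef_poly /= mulr0 addr0.
apply: eq_bigr => j _; rewrite altE; last first.
  by rewrite (leq_trans _ (ltnW le)) // -ltnS.
rewrite coef_poly ltnS (leq_trans (leq_subr _ _)) //.
by rewrite subn_eq0 leqNgt ltn_ord mulrA.
Qed.

Let newtonP L P : L 0%N = 1 ->
  newton L P <-> forall n, lowz n (alt L n * psp P n + 'X * (alt L n)^`()).
Proof.
move=> L0; split=> [[_ h] n [|i] le|h].
- by rewrite coefD coefXM coefM big_ord1 /= subnn [X in _ * X]coef_poly mulr0 addr0.
- by rewrite newton_coef // h // subrr.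
split=> // -[|n] // _; have := h n.+1 n.+1 (leqnn _).
by rewrite newton_coef // => /eqP; rewrite subr_eq0 => /eqP.
Qed.

(** The logarithmic derivative of a product is the sum of the logarithmic derivatives. *)
Lemma newton_conv L L' P P' : newton L P -> newton L' P' ->
  newton (conv L L') (fun n => P n + P' n).
Proof.
move=> nL nL'; have [L0 L0'] := (nL.1, nL'.1).
have C0 : conv L L' 0%N = 1 by rewrite /conv big_ord1 L0 L0' mulr1.
apply/(newtonP _ C0) => n.
move/(newtonP _ L0)/(_ n): nL => nL; move/(newtonP _ L0')/(_ n): nL' => nL'.
set l := alt L n in nL *; set l' := alt L' n in nL' *.
(* The product of the truncations and the truncation of the product agree up to t^n. *)
have hc : lowz n (l * l' - alt (conv L L') n).
  move=> i le; rewrite coefB altE // coefM /conv big_distrr -sumrB big1 // => j _.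
  have lj : (j <= i)%N by rewrite -ltnS ltn_ord.
  rewrite !altE ?(leq_trans _ le) ?leq_subr //=.
  by rewrite mulrACA -exprD subnKC // subrr.
have pE : psp (fun n => P n + P' n) n = psp P n + psp P' n.
  apply/polyP => i; rewrite coefD !coef_poly; case: ifP => // _; last by rewrite addr0.
  by case: ifP => // _; rewrite addr0.
set c := alt _ n in hc *; rewrite pE.
(* The Leibniz rule for [l * l'], with the error made by using [c] instead subtracted at the end. *)
have -> : c * (psp P n + psp P' n) + 'X * c^`() =
    (l' * (l * psp P n + 'X * l^`()) + l * (l' * psp P' n + 'X * l'^`()))
    - ((psp P n + psp P' n) * (l * l' - c) + 'X * (l * l' - c)^`()).
  rewrite derivB derivM; ring.
by apply: lowzB; apply: lowzD; first [exact: lowzXd | exact: lowzM].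
Qed.

Lemma newton_gen1 (u : A) : newton (fun k => (1 + u *: 'X)`_k) (fun n => u ^+ n).
Proof.
have cE k : (1 + u *: 'X)`_k = (k == 0%N)%:R + u * (k == 1%N)%:R.
  by rewrite coefD coefZ coefX coef1.
split=> [|[|[|n]] // _]; rewrite ?cE ?mulr0 ?addr0 //.
  by rewrite big_ord1 !cE /= !mul1r mulr0 mulr1 add0r addr0 mul1r.
rewrite big_ord_recl big_ord_recl /= big1 => [|i _]; last first.
  by rewrite cE /= mulr0 addr0 mul0r mulr0.
rewrite !cE /= !mulr0 !addr0 !mulr1 !add0r mul0rn mulr0 expr0 expr1 !mul1r.
by rewrite /bump /= subn1 subn0 mulN1r -exprS subrr.
Qed.

(** For [- u] the series is 1 / (1 + ut), whose coefficients are the powers of [- u]. *)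
Lemma newton_opp_powers (u : A) : newton (fun k => (- u) ^+ k) (fun n => - u ^+ n).
Proof.
split=> // n n_gt0; rewrite (eq_bigr (fun _ => - u ^+ n)) => [|k _].
  rewrite sumr_const card_ord mulrnAr; congr (_ *+ _).
  case: n n_gt0 => // n _.
  by rewrite [(- u) ^+ _]exprS mulrCA -exprMn mulN1r opprK mulNr -exprS.
by rewrite mulrA -exprMn mulN1r opprK mulrN -exprD subnKC // ltnW.
Qed.

Lemma newton_gen (u : seq A) :
  newton (fun k => (\prod_(x <- u) (1 + x *: 'X))`_k) (fun n => \sum_(x <- u) x ^+ n).
Proof.
elim: u => [|x u IH].
  split=> [|n n_gt0]; first by rewrite big_nil coef1.
  rewrite big1 => [|k _]; last by rewrite !big_nil !mulr0.
  by rewrite big_nil coef1 eqn0Ngt n_gt0 mul0rn mulr0.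
have [h1 h2] := newton_conv (newton_gen1 x) IH.
split=> [|n n_gt0].
  by rewrite -[RHS]h1 /conv big_cons coefM.
rewrite big_cons coefM -[X in X *+ _]/(conv _ _ n) -h2 //; apply: eq_bigr => k _.
by rewrite !big_cons coefM.
Qed.

End Newton.

(** * Lambda-operations of integer polynomials *)

Section LambdaPoly.
Variable K : nat.
Implicit Types (p q : {mpoly int[K]}) (L : nat -> {mpoly int[K]}).

Definition psi n : {mpoly int[K]} -> {mpoly int[K]} := evalZ (fun i => 'X_i ^+ n).

Lemma psiX n m : psi n 'X_[m] = 'X_[m] ^+ n.
Proof.
rewrite /psi evalZXm mpolyXE_id -prodrXl.
by apply: eq_bigr => i _; rewrite -!exprM mulnC.
Qed.

Definition is_lam p L := newton L (fun n => psi n p).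

Lemma mpoly_mulrnI n p q : (0 < n)%N -> p *+ n = q *+ n -> p = q.
Proof.
move=> n_gt0 e; apply/mpolyP => m; have := congr1 (mcoeff m) e.
rewrite !mcoeffMn => /eqP; rewrite -subr_eq0 -mulrnBl mulrn_eq0 eqn0Ngt n_gt0 /=.
by rewrite subr_eq0 => /eqP.
Qed.

(** Newton's equation determines n L_n from the earlier terms, and integer polynomials have no
    torsion. *)
Lemma is_lam_uniq p L L' : is_lam p L -> is_lam p L' -> L =1 L'.
Proof.
move=> [h0 h] [h0' h'] n; elim/ltn_ind: n => -[|n] IH; first by rewrite h0 h0'.
apply: (@mpoly_mulrnI n.+1) => //; apply/(@mulrI _ ((-1) ^+ n)).
  by rewrite unitrX // unitrN1.
have := h n.+1 isT; have := h' n.+1 isT => /= <- <-.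
by apply: eq_bigr => k _; rewrite IH.
Qed.

Lemma is_lamD p q L L' : is_lam p L -> is_lam q L' -> is_lam (p + q) (conv L L').
Proof.
move=> hL hL'; have [h0 h] := newton_conv hL hL'; split=> // n n_gt0.
by rewrite -h //; apply: eq_bigr => k _; rewrite /psi rmorphD.
Qed.

Lemma is_lam_gen (u : seq 'X_{1..K}) :
  is_lam (\sum_(m <- u) 'X_[m]) (fun k => (\prod_(m <- u) (1 + 'X_[m] *: 'X))`_k).
Proof.
have [] := newton_gen [seq 'X_[m] : {mpoly int[K]} | m <- u].
rewrite /= big_map => h0 h.
split=> // n n_gt0; rewrite -h //.
apply: eq_bigr => k _; rewrite big_map [psi _ _]rmorph_sum.
by do 2 congr (_ * _); apply: eq_bigr => m _; apply: psiX.
Qed.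

Lemma is_lam0 : is_lam 0 (fun n => (n == 0%N)%:R).
Proof.
have := is_lam_gen [::]; rewrite big_nil => -[h0 h]; split=> // n n_gt0.
have := h n n_gt0; rewrite big_nil coef1 => <-.
by apply: eq_bigr => k _; rewrite coef1.
Qed.

Lemma is_lam_ex p : exists L, is_lam p L.
Proof.
suff h (m : 'X_{1..K}) (c : int) : exists L, is_lam (c *: 'X_[m]) L.
  elim/mpolyind: p => [|c m p _ _ [L hL]]; first by eexists; apply: is_lam0.
  have [L' hL'] := h m c; by eexists; apply: is_lamD hL' hL.
elim/int_ind: c => [|n [L hL]|n [L hL]].
- by eexists; rewrite scale0r; apply: is_lam0.
- eexists; rewrite intS scalerDl scale1r; apply: is_lamD hL.
  by have := is_lam_gen [:: m]; rewrite big_seq1; apply.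
- eexists; rewrite intS opprD scalerDl scaleN1r; apply: is_lamD hL.
  have [h0 h1] := newton_opp_powers ('X_[m] : {mpoly int[K]}).
  split; [exact: h0|] => k k_gt0; rewrite -h1 //; apply: eq_bigr => j _.
  by rewrite /psi rmorphN /= -/(psi _ _) psiX.
Qed.

End LambdaPoly.

(** * The universal polynomials of the ring of Witt vectors *)

Lemma eq_evalZ_supp (R : comPzRingType) K (v v' : 'I_K -> R) (F : {mpoly int[K]}) :
  (forall a k, a \in msupp F -> a k != 0%N -> v k = v' k) -> evalZ v F = evalZ v' F.
Proof.
move=> h; rewrite /evalZ; apply: eq_big_seq => a aF; congr (_ * _).
apply: eq_bigr => k _; case: (eqVneq (a k) 0%N) => [->|/(h _ _ aF) ->] //.
Qed.

Section Pad.
Variables (A : comNzRingType) (n : nat) (x : 'I_n -> A).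

(** Extension by zeros specialises an identity in N variables to fewer variables: in a generating
    product each added zero contributes the factor 1. *)
Definition pad i : A := oapp x 0 (insub i).

Lemma padE (i : 'I_n) : pad i = x i.
Proof. by rewrite /pad valK. Qed.

Lemma pad_ge i : (n <= i)%N -> pad i = 0.
Proof. by move=> le; rewrite /pad insubN // -leqNgt. Qed.

Lemma prod_pad N (G : A -> {poly A}) : (n <= N)%N -> G 0 = 1 ->
  \prod_(i < N) G (pad i) = \prod_(i < n) G (x i).
Proof.
move=> le G0; under [RHS]eq_bigr => i _ do rewrite -padE.
rewrite (big_ord_widen _ (fun i => G (pad i)) le) [RHS]big_mkcond.
by apply: eq_bigr => i _; case: ltnP => // /pad_ge ->.
Qed.

(** A subset that reaches into the padding contributes [G 0 = 1]; the others are the images of the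
    subsets of ['I_n]. *)
Lemma prod_pad_sets N m (G : A -> {poly A}) : (n <= N)%N -> G 0 = 1 ->
  \prod_(S : {set 'I_N} | #|S| == m) G (\prod_(i in S) pad i) =
  \prod_(S : {set 'I_n} | #|S| == m) G (\prod_(i in S) x i).
Proof.
move=> le G0; pose f := widen_ord le.
have f_inj : injective f by move=> i j /(congr1 val) /= /val_inj.
rewrite (bigID (fun S : {set 'I_N} => [forall i in S, (i < n)%N])) /=.
rewrite [X in _ * X]big1 ?mulr1 => [|S /andP[_ /forall_inPn[i iS]]]; last first.
  by rewrite -leqNgt => /pad_ge h; rewrite (bigD1 i) //= h mul0r.
rewrite (reindex_onto (fun S : {set 'I_n} => f @: S) (fun S => f @^-1: S)) /=.
  apply: eq_big => [S|S _].
    rewrite card_imset // [X in _ && X](_ : _ = true) ?andbT.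
      by rewrite andb_idr // => _; apply/forall_inP => i /imsetP[j _ ->] /=.
    by apply/eqP/setP => i; rewrite inE mem_imset.
  by rewrite big_imset /=; [congr G; apply: eq_bigr => i _; rewrite padE | move=> i j _ _ /f_inj].
move=> S /andP[_ /forall_inP h]; apply/setP => i; apply/imsetP/idP.
  by case=> j; rewrite inE => jS ->.
by move=> iS; exists (Ordinal (h i iS)); [rewrite inE | ]; rewrite (_ : f _ = i) //; apply: val_inj.
Qed.

End Pad.

Lemma prod_split_ord (A : comNzRingType) N M (P : pred 'I_(N + M)) (F : 'I_(N + M) -> A) :
  \prod_(i | P i) F i = (\prod_(i | P (lshift M i)) F (lshift M i)) *
    (\prod_(i | P (rshift N i)) F (rshift N i)).
Proof. exact: big_split_ord. Qed.

(** Used to exclude elementary symmetric functions of too high a degree from the universal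
    polynomials. *)
Lemma whomog_supp_le K (w : 'I_K -> nat) d (F : {mpoly int[K]}) :
  (forall a, a \in msupp F -> wt w a = d) ->
  forall a k, a \in msupp F -> a k != 0%N -> (w k <= d)%N.
Proof.
move=> h a k /h <- nz; rewrite /wt (bigD1 k) //= (leq_trans _ (leq_addr _ _)) //.
by rewrite leq_pmulr // lt0n.
Qed.

(* [is_Pn] only concerns [n] variables of each kind; for sums of more than [n] monomials one
   needs the identity with [N] variables, which holds for the same [P] because [P] has degree
   [n] in each kind of variables, and which specialises to [is_Pn]. *)
Lemma Pn_ex n N : (n <= N)%N -> exists P : {mpoly int[n + n]}, is_Pn P /\
  forall (A : comNzRingType) (x y : 'I_N -> A),
  evalZ (fun v : 'I_(n + n) => match split v with
    | inl i => (\prod_i (1 + x i *: 'X))`_i.+1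
    | inr j => (\prod_j (1 + y j *: 'X))`_j.+1 end) P
  = (\prod_i \prod_j (1 + (x i * y j) *: 'X))`_n.
Proof.
move=> le.
(* Two rows: the variables x come first, the variables y after them. *)
pose row (k : 'I_(N + N)) : nat := (N <= k)%N.
pose rank (k : 'I_(N + N)) := (if k < N then k : nat else k - N)%N.
have mono k k' : row k = row k' -> (rank k < rank k')%N = (k < k')%N.
  by rewrite /row /rank; case: (leqP N k); case: (leqP N k') => //= ? ? _; lia.
have sat k j : (j < rank k)%N -> exists k', row k' = row k /\ rank k' = j.
  move=> lj; have lk := ltn_ord k.
  have b : ((if k < N then j else N + j) < N + N)%N.
    by move: lj; rewrite /rank; case: (leqP N k) => /=; lia.
  exists (Ordinal b); move: lj; rewrite /row /rank /=; case: (leqP N k) => /= ? lj.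
    by rewrite leq_addr ltnNge leq_addr /= addKn.
  have lN : (j < N)%N by lia.
  by rewrite lN (leqNgt N j) lN. 
pose p : {mpoly int[N + N]} := (\prod_(ab : 'I_(N + N) * 'I_(N + N)
   | (row ab.1 == 0%N) && (row ab.2 == 1%N)) (1 + ('X_ab.1 * 'X_ab.2) *: 'X))`_n.
have sp : row_sym row p.
  move=> s hs; rewrite /p (rmorph_gen (msym s)).
  rewrite (reindex (fun ab => (s^-1 ab.1, s^-1 ab.2)%g)) /=; last first.
    by exists (fun ab => (s ab.1, s ab.2)) => -[a b] _ /=; rewrite ?permK ?permKV.
  apply: eq_gen => [[a b]|[a b] _] /=.
    by rewrite -(hs (s^-1 a)%g) -(hs (s^-1 b)%g) !permKV.
  by rewrite msymM !msymU !permKV.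
have [F [eF hF]] := row_sym_evalZ_ex mono sat sp.
(* The weight counting only the variables of row [r] equals n on [p], so no elementary symmetric
   function of degree above n occurs in [F]. *)
have rankF a k : a \in msupp F -> a k != 0%N -> (rank k < n)%N.
  move=> aF ak.
  have hw r : (r < 2)%N -> (forall a, a \in msupp F -> wt (fun k => (row k == r) * (rank k).+1)%N a = n).
    move=> r2; apply: (hF (fun k => row k == r) (fun d => d = n)) => [i j ->//|].
    have := @whomog_gen _ (fun k => row k == r) _ _ _ 1 n; rewrite mul1n; apply.
    move=> [i j] /= /andP[/eqP ri /eqP rj].
    rewrite (_ : 1 = (row i == r) + (row j == r))%N; last first.
      by rewrite ri rj; case: r r2 => [|[|]].
    by apply: whomogM; apply: (whomogU (fun k => row k == r)).
  have r2 : (row k < 2)%N by rewrite /row; case: (N <= k)%N.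
  have := whomog_supp_le (hw _ r2) aF ak; by rewrite eqxx mul1n.
(* By [rankF], sending the variables of rank at least n to 0 loses nothing. *)
pose c (k : 'I_(N + N)) : {mpoly int[n + n]} := match split k with
  | inl i => pad (fun i => 'X_(lshift n i)) i
  | inr j => pad (fun j => 'X_(rshift n j)) j end.
have rowl i : row (lshift N i) = 0%N by rewrite /row /= leqNgt ltn_ord.
have rowr i : row (rshift N i) = 1%N by rewrite /row leq_addr.
have main (A : comNzRingType) (x y : 'I_N -> A) :
  evalZ (fun v : 'I_(n + n) => match split v with
    | inl i => (\prod_i (1 + x i *: 'X))`_i.+1
    | inr j => (\prod_j (1 + y j *: 'X))`_j.+1 end) (evalZ c F)
  = (\prod_i \prod_j (1 + (x i * y j) *: 'X))`_n.
  rewrite evalZ_comp.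
  pose z k := match split k with inl i => x i | inr j => y j end.
  have zl i : z (lshift N i) = x i by rewrite /z (unsplitK (inl _ i)).
  have zr i : z (rshift N i) = y i by rewrite /z (unsplitK (inr _ i)).
  transitivity (evalZ (fun k => evalZ z (row_esym row rank k)) F).
    apply: eq_evalZ_supp => a k aF ak.
    rewrite /row_esym (rmorph_gen (evalZ z)).
    rewrite (eq_gen (Q := fun i => row i == row k) (y := z)) => [|//|i _]; last exact: evalZX.
    have eL : \prod_(i | row (lshift N i) == row k) (1 + z (lshift N i) *: 'X) =
        \prod_(i | 0%N == row k) (1 + x i *: 'X).
      by apply: eq_big => [i|i _]; rewrite ?rowl ?zl.
    have eR : \prod_(i | row (rshift N i) == row k) (1 + z (rshift N i) *: 'X) =
        \prod_(i | 1%N == row k) (1 + y i *: 'X).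
      by apply: eq_big => [i|i _]; rewrite ?rowr ?zr.
    rewrite prod_split_ord eL eR.
    have rk := rankF _ _ aF ak; rewrite /c.
    case: (splitP k) => i ki.
      have -> : row k = 0%N by rewrite /row ki leqNgt ltn_ord.
      have rE : rank k = i by rewrite /rank ki ltn_ord.
      rewrite [X in _ * X]big_pred0 ?mulr1 // rE.
      rewrite rE in rk; rewrite -[nat_of_ord i]/(nat_of_ord (Ordinal rk)) padE evalZX.
      by rewrite (unsplitK (inl _ (Ordinal rk))).
    have -> : row k = 1%N by rewrite /row ki leq_addr.
    have rE : rank k = i by rewrite /rank ki ltnNge leq_addr /= addKn.
    rewrite [X in X * _]big_pred0 ?mul1r // rE.
    rewrite rE in rk; rewrite -[nat_of_ord i]/(nat_of_ord (Ordinal rk)) padE evalZX.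
    by rewrite (unsplitK (inr _ (Ordinal rk))).
  rewrite -evalZ_comp eF /p (rmorph_gen (evalZ z)).
  rewrite -(pair_big (fun a => row a == 0%N) (fun b => row b == 1%N)
    (fun a b => 1 + evalZ z ('X_a * 'X_b) *: 'X)) /=.
  rewrite prod_split_ord [X in _ * X]big_pred0 ?mulr1 => [|i]; last by rewrite rowr.
  congr ((polyseq _)`_ _); apply: eq_big => [i|i _]; first by rewrite rowl.
  rewrite prod_split_ord [X in X * _]big_pred0 ?mul1r => [|j]; last by rewrite rowl.
  apply: eq_big => [j|j _]; first by rewrite rowr.
  by rewrite rmorphM /= !evalZX zl zr.
(* Setting the variables beyond the first n of each kind to 0 turns [main] into [is_Pn]. *)
exists (evalZ c F); split=> //; rewrite /is_Pn.
have := main {mpoly int[n + n]} (fun i : 'I_N => pad (fun i => 'X_(lshift n i)) i)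
  (fun i : 'I_N => pad (fun i => 'X_(rshift n i)) i).
set X := fun i : 'I_n => 'X_(lshift n i); set Y := fun i : 'I_n => 'X_(rshift n i).
have -> : \prod_(i < N) \prod_(j < N) (1 + (pad X i * pad Y j) *: 'X) =
    \prod_(i < n) \prod_(j < n) (1 + (X i * Y j) *: 'X).
  rewrite -(prod_pad X (G := fun x => \prod_j (1 + (x * Y j) *: 'X)) le); last first.
    by rewrite big1 // => j _; rewrite mul0r scale0r addr0.
  apply: eq_bigr => i _.
  by rewrite (prod_pad Y (G := fun y => 1 + (pad X i * y) *: 'X) le) // mulr0 scale0r addr0.
rewrite esymfE pair_big /= => <-; apply: eq_evalZ => v; case: (split v) => i.
  by rewrite esymfE (prod_pad _ (G := fun x => 1 + x *: 'X)) // scale0r addr0.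
by rewrite esymfE (prod_pad _ (G := fun x => 1 + x *: 'X)) // scale0r addr0.
Qed.

(** Here one row is enough: e_n of the products of m variables is symmetric of degree nm, so only
    e_1, ..., e_(nm) occur, however large N is. *)
Lemma Pnm_ex n m N : (n * m <= N)%N -> exists P : {mpoly int[n * m]}, is_Pnm P /\
  forall (A : comNzRingType) (x : 'I_N -> A),
  evalZ (fun v : 'I_(n * m) => (\prod_i (1 + x i *: 'X))`_v.+1) P
  = (\prod_(S : {set 'I_N} | #|S| == m) (1 + (\prod_(i in S) x i) *: 'X))`_n.
Proof.
move=> le.
pose row (k : 'I_N) := 0%N; pose rank (k : 'I_N) : nat := k.
have mono k k' : row k = row k' -> (rank k < rank k')%N = (k < k')%N by [].
have sat k j : (j < rank k)%N -> exists k', row k' = row k /\ rank k' = j.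
  by move=> lj; exists (Ordinal (ltn_trans lj (ltn_ord k))).
pose p : {mpoly int[N]} :=
  (\prod_(S : {set 'I_N} | #|S| == m) (1 + (\prod_(i in S) 'X_i) *: 'X))`_n.
have sp : row_sym row p.
  move=> s _; rewrite /p (rmorph_gen (msym s)).
  rewrite (reindex (fun S : {set 'I_N} => s^-1%g @: S)) /=; last first.
    exists (fun S : {set 'I_N} => s @: S) => S _ /=; rewrite -imset_comp;
      rewrite -[RHS]imset_id; apply: eq_imset => i /=; by rewrite ?permK ?permKV.
  apply: eq_gen => [S|S _]; first by rewrite card_imset //; apply: perm_inj.
  rewrite big_imset /=; last by move=> i j _ _; apply: perm_inj.
  by rewrite rmorph_prod /=; apply: eq_bigr => i _; rewrite msymU permKV.
have [F [eF hF]] := row_sym_evalZ_ex mono sat sp.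
have rankF a k : a \in msupp F -> a k != 0%N -> (k < n * m)%N.
  have hw : forall a, a \in msupp F -> wt (fun k => 1 * (rank k).+1)%N a = (m * n)%N.
    apply: (hF (fun=> 1%N) (fun d => d = (m * n)%N)) => //.
    apply: whomog_gen => S /eqP <-; rewrite -sum1_card; apply: whomog_prod => i _.
    exact: (whomogU (fun=> 1%N)).
  by move=> aF ak; have := whomog_supp_le hw aF ak; rewrite mul1n mulnC.
have main (A : comNzRingType) (x : 'I_N -> A) :
  evalZ (fun v : 'I_(n * m) => (\prod_i (1 + x i *: 'X))`_v.+1)
    (evalZ (fun k : 'I_N => pad (fun i => 'X_i) k) F)
  = (\prod_(S : {set 'I_N} | #|S| == m) (1 + (\prod_(i in S) x i) *: 'X))`_n.
  rewrite evalZ_comp.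
  transitivity (evalZ (fun k => evalZ x (row_esym row rank k)) F).
    apply: eq_evalZ_supp => a k aF ak; have rk := rankF _ _ aF ak.
    rewrite /row_esym (rmorph_gen (evalZ x)) /=.
    rewrite -[nat_of_ord k]/(nat_of_ord (Ordinal rk)) padE evalZX.
    by apply: eq_gen => // i _; rewrite evalZX.
  rewrite -evalZ_comp eF /p (rmorph_gen (evalZ x)).
  apply: eq_gen => // S _; rewrite rmorph_prod.
  by apply: eq_bigr => i _; apply: evalZX.
exists (evalZ (fun k : 'I_N => pad (fun i => 'X_i) k) F); split=> //; rewrite /is_Pnm.
have := main {mpoly int[n * m]} (fun i : 'I_N => pad (fun i => 'X_i) i).
rewrite (prod_pad_sets _ _ (G := fun x => 1 + x *: 'X)) //; last by rewrite scale0r addr0.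
move=> e; rewrite esymfE (eq_evalZ (w := fun v : 'I_(n * m) =>
  (\prod_(i < N) (1 + pad (fun i => 'X_i) i *: 'X))`_v.+1)) => [|v]; last first.
  by rewrite esymfE (prod_pad _ (G := fun x => 1 + x *: 'X)) // scale0r addr0.
rewrite e (reindex_omap (val : {S : {set 'I_(n * m)} | #|S| == m} -> _) insub) /= => [|S cS]; last by rewrite insubT.
congr ((polyseq _)`_ _); apply: eq_bigl => S.
by rewrite valK eqxx (valP S).
Qed.

(** * Monomials and formal sums *)

Lemma monoP (a b : mono) : (forall k, a k = b k) -> a = b.
Proof. by move=> h; apply/fsfunP. Qed.

Lemma supp_neq0 (m : mono) k : (k \in finsupp m) = (m k != 0%N).
Proof. exact: mem_finsupp. Qed.

Lemma mdeg_big (m : mono) (s : seq (nat * nat)) :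
  uniq s -> {subset finsupp m <= s} ->
  Defs.mdeg m = (\sum_(k <- s) m k * k.1.+1)%N.
Proof.
move=> us sub; rewrite /Defs.mdeg [RHS](bigID (fun k => k \in finsupp m)) /=.
rewrite [X in (_ + X)%N]big1 ?addn0 => [|k]; last by move/fsfun_dflt ->.
rewrite -[RHS]big_filter; apply: perm_big; apply: uniq_perm; rewrite ?fset_uniq ?filter_uniq //.
by move=> k; rewrite mem_filter andb_idr // => /sub.
Qed.

Definition msub (m a : mono) : mono := [fsfun k in finsupp m => (m k - a k)%N | 0%N].

Lemma msubE m a k : msub m a k = (m k - a k)%N.
Proof. by rewrite fsfun_fun; case: finsuppP. Qed.

Lemma mono_ofE (m : mono) c (k : finsupp m) : mono_of c (val k) = c k.
Proof. by rewrite fsfun_ffun valK. Qed.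

Lemma mono_of_out (m : mono) (c : {ffun finsupp m -> 'I_(mbound m).+1}) k :
  k \notin finsupp m -> mono_of c k = 0%N.
Proof. by move=> h; rewrite fsfun_ffun insubN. Qed.

Lemma mono_coE (m : mono) (c : {ffun finsupp m -> 'I_(mbound m).+1}) :
  mono_co c = msub m (mono_of c).
Proof.
apply: monoP => k; rewrite msubE /mono_co fsfun_ffun; case: insubP => [u uk <-|nk] /=.
  by rewrite mono_ofE.
by rewrite mono_of_out // fsfun_dflt.
Qed.

Lemma mono_of_inj (m : mono) : injective (@mono_of m).
Proof.
move=> c d e; apply/ffunP => k; apply: val_inj => /=.
by rewrite -!mono_ofE e.
Qed.

Lemma mbound_ge (m : mono) k : (m k <= mbound m)%N.
Proof.
case: finsuppP => // kf; rewrite /mbound.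
exact: (leq_bigmax_seq (F := fun k => m k) k).
Qed.

Definition mdivs (m : mono) : seq mono :=
  [seq mono_of c | c : {ffun finsupp m -> 'I_(mbound m).+1} in [pred c : {ffun finsupp m -> 'I_(mbound m).+1} | [forall k, (c k <= m (val k))%N]]].

Lemma mem_mdivs (m a : mono) : reflect (forall k, (a k <= m k)%N) (a \in mdivs m).
Proof.
apply: (iffP imageP) => [[c /forallP h ->] k|h].
  case: (boolP (k \in finsupp m)) => kf; last by rewrite mono_of_out.
  by have := h [` kf]%fset; rewrite -mono_ofE.
exists [ffun k : finsupp m => inord (a (val k))].
  apply/forallP => k; rewrite ffunE inordK //.
  by rewrite ltnS (leq_trans (h _)) // mbound_ge.
apply: monoP => k; case: (boolP (k \in finsupp m)) => kf.
  rewrite -[k]/(val [` kf]%fset) mono_ofE ffunE inordK //.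
  by rewrite ltnS (leq_trans (h _)) // mbound_ge.
rewrite mono_of_out //; have := h k; by rewrite [m k]fsfun_dflt // leqn0 => /eqP ->.
Qed.

Lemma mdivs_uniq m : uniq (mdivs m).
Proof. by rewrite map_inj_uniq ?enum_uniq //; apply: mono_of_inj. Qed.

(** Any list of the divisors of [m] may be used, so products can be compared along a bijection
    between sets of divisors. *)
Lemma PSmulE f g (m : mono) (s : seq mono) : uniq s ->
  (forall a : mono, reflect (forall k, (a k <= m k)%N) (a \in s)) ->
  PSmul f g m = \sum_(a <- s) f a * g (msub m a).
Proof.
move=> us hs; rewrite (perm_big (mdivs m)) /=; last first.
  apply: uniq_perm => //; first exact: mdivs_uniq.
  by move=> a; apply/hs/mem_mdivs.
rewrite /mdivs big_map big_enum /=; apply: eq_bigr => c _.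
by rewrite mono_coE.
Qed.

Lemma PSmul_neq0 f g m : PSmul f g m != 0 ->
  exists a b : mono, [/\ f a != 0, g b != 0 & Defs.mdeg m = (Defs.mdeg a + Defs.mdeg b)%N].
Proof.
rewrite (PSmulE _ _ (mdivs_uniq m) (mem_mdivs m)) => nz.
have /hasP[a am] : has (fun a => f a * g (msub m a) != 0) (mdivs m).
  apply: contraNT nz => /hasPn h; rewrite big_seq big1 // => a /h.
  by rewrite negbK => /eqP.
rewrite mulf_eq0 negb_or => /andP[fa gb]; exists a, (msub m a); split=> //.
move/mem_mdivs: am => am.
have sub (b : mono) : (forall k, (b k <= m k)%N) -> {subset finsupp b <= finsupp m}.
  move=> h k; rewrite !supp_neq0 -!lt0n => /leq_trans; apply; exact: h.
rewrite !(mdeg_big (s := finsupp m)) ?fset_uniq //; last 2 first.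
- by apply: sub => k; rewrite msubE leq_subr.
- exact: sub.
rewrite -big_split; apply: eq_bigr => k _ /=.
by rewrite msubE -mulnDl subnKC.
Qed.

Section Act.
Variables (s t : nat * nat -> nat * nat).
Hypotheses (stK : cancel s t) (tsK : cancel t s).

Definition act_mono (m : mono) : mono := [fsfun k in [fset s x | x in finsupp m]%fset => m (t k) | 0%N].

Lemma act_monoE m k : act_mono m k = m (t k).
Proof.
rewrite fsfun_fun; case: imfsetP => // h; apply/esym/eqP.
apply: contraPT (h) => nz; case; exists (t k); last by rewrite tsK.
by rewrite /= supp_neq0.
Qed.

End Act.

Lemma mdeg_act (s : nat * nat -> nat * nat) (m m' : mono) :
  bijective s -> (forall k, (s k).1 = k.1) -> (forall k, m' (s k) = m k) ->
  Defs.mdeg m' = Defs.mdeg m.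
Proof.
move=> [t stK tsK] rs e.
rewrite (mdeg_big (m := m') (s := [seq s k | k <- finsupp m])).
- by rewrite big_map (mdeg_big (s := finsupp m)) ?fset_uniq //; apply: eq_bigr => k _; rewrite e rs.
- by rewrite map_inj_uniq ?fset_uniq //; apply: can_inj stK.
move=> k; rewrite supp_neq0 -[k]tsK e -supp_neq0 => h; exact: map_f.
Qed.

(** The permutation carries the divisors of [m] bijectively to those of [m'], and commutes with
    taking quotients. *)
Lemma row_invariant_mul f g :
  row_invariant f -> row_invariant g -> row_invariant (PSmul f g).
Proof.
move=> hf hg s bs rs m m' e; have [t stK tsK] := bs.
rewrite (PSmulE _ _ (mdivs_uniq m) (mem_mdivs m)).
rewrite (PSmulE f g (s := [seq act_mono s t a | a <- mdivs m])) => [||a].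
- rewrite big_map; apply: eq_bigr => a _; congr (_ * _).
    by apply: (hf s) => // k; rewrite act_monoE // stK.
  by apply: (hg s) => // k; rewrite !msubE act_monoE // stK e.
- rewrite map_inj_in_uniq ?mdivs_uniq // => a b _ _ h.
  by apply: monoP => k; have := congr1 (fun m : mono => m (s k)) h; rewrite /= !act_monoE // stK.
apply: (iffP mapP) => [[b /mem_mdivs hb -> k]|h].
  by rewrite act_monoE // -[k in m' k]tsK e hb.
exists (act_mono t s a); last by apply: monoP => k; rewrite !act_monoE // tsK.
by apply/mem_mdivs => k; rewrite act_monoE // -e.
Qed.

Lemma mdivnE n m k : mdivn n m k = (m k %/ n)%N.
Proof.
rewrite fsfun_ffun; case: insubP => [u uk <-|nk] //=.
by rewrite fsfun_dflt // div0n.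
Qed.

Lemma PSpsiE n f (m : mono) : (forall k, n %| m k)%N -> PSpsi n f m = f (mdivn n m).
Proof. by move=> h; rewrite /PSpsi; case: forallP => // -[] k. Qed.

Lemma PSpsi0 n f (m : mono) k : ~~ (n %| m k)%N -> PSpsi n f m = 0.
Proof.
move=> nk; rewrite /PSpsi; case: forallP => // h.
case: (boolP (k \in finsupp m)) nk => kf; last by rewrite fsfun_dflt // dvdn0.
by have := h [` kf]%fset => /= ->.
Qed.

Lemma row_invariant_psi n f : row_invariant f -> row_invariant (PSpsi n f).
Proof.
move=> hf s bs rs m m' e; have [t stK tsK] := bs.
case: (boolP [forall k : finsupp m, n %| m (val k)]%N) => [/forallP h|].
  have hm k : (n %| m k)%N.
    case: (boolP (k \in finsupp m)) => kf; last by rewrite fsfun_dflt // dvdn0.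
    exact: (h [` kf]%fset).
  rewrite !PSpsiE // => [|k]; last by rewrite -[k]tsK e.
  by apply: (hf s) => // k; rewrite !mdivnE e.
move/forallPn => [k nk]; have nk' : ~~ (n %| m' (s (val k)))%N by rewrite e.
by rewrite (PSpsi0 _ nk) (PSpsi0 _ nk').
Qed.

Lemma PSpsi_neq0 n f m : (0 < n)%N -> PSpsi n f m != 0 ->
  exists a, f a != 0 /\ Defs.mdeg m = (n * Defs.mdeg a)%N.
Proof.
move=> n_gt0; rewrite /PSpsi; case: forallP => [h|]; last by rewrite eqxx.
move=> nz; exists (mdivn n m); split=> //.
rewrite !(mdeg_big (s := finsupp m)) ?fset_uniq //; last first.
  by move=> k; rewrite !supp_neq0 mdivnE; apply: contra => /eqP->; rewrite div0n.
rewrite big_distrr /= big_seq [RHS]big_seq; apply: eq_bigr => k kf.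
by rewrite mdivnE mulnA [(n * _)%N]mulnC divnK //; apply: (h [` kf]%fset).
Qed.

(** * Truncation to finitely many variables *)

Section Trunc.
Variable N : nat.
Implicit Types (a b : 'X_{1..N * N}) (p q : {mpoly int[N * N]}) (f g : mono -> int).

Definition key (t : 'I_(N * N)) : nat * nat := (t %/ N, t %% N)%N.

Lemma N_gt0 (t : 'I_(N * N)) : (0 < N)%N.
Proof. by case: N t => // -[]. Qed.

Lemma key1 t : ((key t).1 < N)%N.
Proof. by rewrite /key /= ltn_divLR // (N_gt0 t). Qed.

Lemma key2 t : ((key t).2 < N)%N.
Proof. by rewrite /key /= ltn_mod (N_gt0 t). Qed.

Lemma key_inj : injective key.
Proof.
move=> s t [e1 e2]; apply: val_inj => /=.
by rewrite (divn_eq s N) (divn_eq t N) e1 e2.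
Qed.

Lemma keyP k : reflect (exists t, key t = k) ((k.1 < N) && (k.2 < N))%N.
Proof.
case: k => i j /=; apply: (iffP andP) => [[hi hj]|[t [<- <-]]]; last first.
  by rewrite (key1 t) (key2 t).
have b : (i * N + j < N * N)%N by nia.
exists (Ordinal b); rewrite /key /=.
by rewrite divnMDl ?(leq_ltn_trans _ hi) // divn_small // addn0 modnMDl modn_small.
Qed.

Definition keys : seq (nat * nat) := [seq key t | t <- enum 'I_(N * N)].

Lemma keys_uniq : uniq keys.
Proof. by rewrite map_inj_uniq ?enum_uniq //; apply: key_inj. Qed.

Lemma mem_keys k : (k \in keys) = ((k.1 < N) && (k.2 < N))%N.
Proof.
apply/mapP/keyP => [[t _ ->]|[t <-]]; first by exists t.
by exists t; rewrite ?mem_enum.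
Qed.

Definition boxed (m : mono) := forall k, m k != 0%N -> (k.1 < N)%N && (k.2 < N)%N.

Definition emb a : mono :=
  [fsfun k in [fset k | k in keys]%fset => nth 0%N a (index k keys) | 0%N].

Lemma emb_key a t : emb a (key t) = a t.
Proof.
rewrite fsfun_fun !inE /= mem_keys key1 key2 /=.
rewrite index_map; last exact: key_inj.
by rewrite index_enum_ord -mnm_nth.
Qed.

Lemma emb_out a k : k \notin keys -> emb a k = 0%N.
Proof. by move=> h; rewrite fsfun_fun !inE /= (negbTE h). Qed.

Lemma emb_boxed a : boxed (emb a).
Proof. by move=> k; rewrite -mem_keys; apply: contraR => /emb_out ->. Qed.

Definition restr (m : mono) : 'X_{1..N * N} := [multinom m (key t) | t < N * N].

Lemma embK : cancel emb restr.
Proof. by move=> a; apply/mnmP => t; rewrite mnmE emb_key. Qed.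

Lemma eq_emb (m : mono) a : boxed m -> (forall t, m (key t) = a t) -> m = emb a.
Proof.
move=> bm e; apply: monoP => k.
case: (boolP (k \in keys)) => [/mapP[t _ ->]|nk]; first by rewrite emb_key.
by rewrite emb_out //; apply/eqP; apply: contraNT nk => /bm; rewrite mem_keys.
Qed.

Lemma restrK (m : mono) : boxed m -> emb (restr m) = m.
Proof. by move=> bm; apply/esym/eq_emb => // t; rewrite mnmE. Qed.

Lemma emb_inj : injective emb.
Proof. exact: can_inj embK. Qed.

Definition kdeg (t : 'I_(N * N)) := (key t).1.+1.

Lemma mdeg_emb a : Defs.mdeg (emb a) = wt kdeg a.
Proof.
rewrite (mdeg_big (s := keys)) ?keys_uniq //; last first.
  by move=> k; rewrite supp_neq0 mem_keys => /emb_boxed.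
rewrite big_map big_enum /=; apply: eq_bigr => t _.
by rewrite emb_key mulnC.
Qed.

(* [p] is the truncation of [f] to the variables [x_(i+1, j+1)] with [i, j < N]. *)
Definition rep p f := forall a, p@_a = f (emb a).

Lemma rep_fun p q f : rep p f -> rep q f -> p = q.
Proof. by move=> hp hq; apply/mpolyP => a; rewrite hp hq. Qed.

Lemma rep_add p q f g : rep p f -> rep q g -> rep (p + q) (PSadd f g).
Proof. by move=> hp hq a; rewrite mcoeffD hp hq. Qed.

Lemma rep_opp p f : rep p f -> rep (- p) (PSopp f).
Proof. by move=> hp a; rewrite mcoeffN hp. Qed.

Lemma rep0 : rep 0 PSzero.
Proof. by move=> a; rewrite mcoeff0. Qed.

Lemma rep1 : rep 1 PSone.
Proof.
move=> a; rewrite mcoeff1 /PSone.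
suff -> : (finsupp (emb a) == fset0) = (a == 0%MM) by case: (a == _).
apply/eqP/eqP => [e|->].
  apply/mnmP => t; rewrite mnm0E -emb_key; apply/eqP.
  by rewrite -[_ == _]negbK -supp_neq0 e inE.
apply/fsetP => k; rewrite supp_neq0 inE; apply/negbTE; rewrite negbK.
by case: (boolP (k \in keys)) => [/mapP[t _ ->]|/emb_out->] //; rewrite emb_key mnm0E.
Qed.

Lemma emb_sub a b : msub (emb a) (emb b) = emb (a - b)%MM.
Proof.
apply: eq_emb => [k|t]; last by rewrite msubE !emb_key mnmBE.
by rewrite msubE => h; apply: (@emb_boxed a); apply: contra h => /eqP->.
Qed.

(** A divisor of a monomial in the truncated variables involves only these variables, so truncation
    respects products. *)
Lemma rep_mul p q f g : rep p f -> rep q g -> rep (p * q) (PSmul f g).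
Proof.
move=> hp hq a; transitivity (\sum_(h : 'X_{1..(N * N) < (mdeg a).+1} | (h <= a)%MM) p@_h * q@_(a - h)).
  by apply: mcoeff_poly_mul_lin; apply: ltnSn.
pose s := [seq emb (val h) | h : 'X_{1..(N * N) < (mdeg a).+1} in [pred h : 'X_{1..(N * N) < (mdeg a).+1} | (h <= a)%MM]].
rewrite (PSmulE _ _ (s := s)) => [||b].
- rewrite big_map big_enum /=; apply: eq_bigr => h _.
  by rewrite hp hq emb_sub.
- rewrite map_inj_uniq ?enum_uniq // => h h' /emb_inj e; exact: val_inj.
apply: (iffP imageP) => [[h /mnm_lepP le -> k]|le].
  by case: (boolP (k \in keys)) => [/mapP[t _ ->]|/emb_out->] //; rewrite !emb_key.
have bb : boxed b.
  by move=> k nz; apply: (@emb_boxed a); rewrite -lt0n (leq_trans _ (le k)) // lt0n.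
have lb : (restr b <= a)%MM by apply/mnm_lepP => t; rewrite mnmE -emb_key.
have db : (mdeg (restr b) < (mdeg a).+1)%N.
  by rewrite ltnS !mdegE; apply: leq_sum => t _; apply: (mnm_lepP lb).
by exists (BMultinom db); rewrite /= ?restrK // inE.
Qed.

Lemma mcoeff_psi n p a : (psi n p)@_a = \sum_(b <- msupp p) p@_b * ((b *+ n)%MM == a)%:R.
Proof.
rewrite /psi mcoeff_evalZ; apply: eq_bigr => b _; congr (_ * _).
by rewrite -/(psi _ _) psiX mcoeffXn.
Qed.

Lemma rep_psi n p f : (0 < n)%N -> rep p f -> rep (psi n p) (PSpsi n f).
Proof.
move=> n_gt0 hp a; rewrite mcoeff_psi.
case: (boolP [forall t, n %| a t]%N) => [/forallP h|/forallPn[t nt]]; last first.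
  rewrite (@PSpsi0 _ _ _ (key t)) ?emb_key // big1 // => b _.
  case: eqP => [e|]; last by rewrite mulr0.
  by case/negP: nt; rewrite -e mulmnE dvdn_mull.
rewrite PSpsiE => [|k]; last first.
  case: (boolP (k \in keys)) => [/mapP[t _ ->]|/emb_out->]; last exact: dvdn0.
  by rewrite emb_key.
pose c := [multinom (a t %/ n)%N | t < N * N].
have -> : mdivn n (emb a) = emb c.
  apply: eq_emb => [k|t]; last by rewrite mdivnE emb_key mnmE.
  by rewrite mdivnE => nz; apply: (@emb_boxed a); apply: contra nz => /eqP->; rewrite div0n.
rewrite -hp [in RHS](mpolyE p) raddf_sum /=; apply: eq_bigr => b _.
rewrite mcoeffZ mcoeffX; congr (_ * (nat_of_bool _)%:R); apply/eqP/eqP => [e|->].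
  by apply/mnmP => t; rewrite mnmE -e mulmnE mulnK.
by apply/mnmP => t; rewrite mulmnE mnmE divnK.
Qed.

Definition bnd D f := forall m, f m != 0 -> (Defs.mdeg m <= D)%N.

(** Every variable has positive degree, so the bound [D] also bounds the total exponent, and
    finitely many monomials remain. *)
Lemma rep_ex D f : bnd D f -> exists p, rep p f.
Proof.
move=> hf; exists (\sum_(b : 'X_{1..(N * N) < D.+1}) f (emb b) *: 'X_[b]) => a.
have [lt|ge] := ltnP (mdeg a) D.+1; first exact: (mcoeff_mpoly (fun b => f (emb b))).
have -> : f (emb a) = 0.
  apply/eqP; apply: contraTT ge => /hf; rewrite -ltnNge ltnS; apply: leq_trans.
  by rewrite mdeg_emb mdegE; apply: leq_sum => t _; rewrite leq_pmull.
rewrite raddf_sum big1 //= => b _; rewrite mcoeffZ mcoeffX.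
case: eqP => [e|]; last by rewrite mulr0.
by have := bmdeg b; rewrite e ltnNge ge.
Qed.

End Trunc.

Lemma boxed_ex (m : mono) : exists N, boxed N m.
Proof.
exists (\max_(k <- finsupp m) maxn k.1 k.2).+1 => k; rewrite -supp_neq0 => kf.
have := leq_bigmax_seq (F := fun k : nat * nat => maxn k.1 k.2) k kf isT.
by rewrite !ltnS geq_max.
Qed.

(** Every monomial is seen by some truncation. This reduces identities between formal sums to
    polynomial rings. *)
Lemma rep_det f g : (forall N, exists p : {mpoly int[N * N]}, rep p f /\ rep p g) -> f = g.
Proof.
move=> h; apply: functional_extensionality => m; have [N bm] := boxed_ex m.
by have [p [hf hg]] := h N; rewrite -(restrK bm) -hf -hg.
Qed.

(** * Moving a monomial of small degree into the truncation box *)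

Definition swap (x y k : nat * nat) := if k == x then y else if k == y then x else k.

Lemma swapK x y : involutive (swap x y).
Proof.
move=> k; rewrite /swap; case: (eqVneq k x) => [->|nx].
  by case: (eqVneq y x) => [->|]; rewrite ?eqxx.
case: (eqVneq k y) => [->|ny]; first by rewrite eqxx.
by rewrite (negbTE nx) (negbTE ny).
Qed.

Lemma swap_row x y k : x.1 = y.1 -> (swap x y k).1 = k.1.
Proof. by rewrite /swap; case: eqP => [->|_] //; case: eqP => [->|]. Qed.

Lemma size_supp_mdeg (m : mono) : (size (finsupp m) <= Defs.mdeg m)%N.
Proof.
rewrite /Defs.mdeg -sum1_size big_seq [leqRHS]big_seq; apply: leq_sum => k.
by rewrite supp_neq0 -lt0n => h; rewrite muln_gt0 h.
Qed.

Lemma box_move N (m : mono) : (Defs.mdeg m <= N)%N -> exists s (m' : mono),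
  [/\ bijective s, forall k, (s k).1 = k.1, forall k, m' (s k) = m k & boxed N m'].
Proof.
move: {2}(count (fun k : nat * nat => N <= k.2)%N (finsupp m)) (leqnn (count (fun k : nat * nat => N <= k.2)%N (finsupp m))) => c.
elim: c m => [|c IH] m hc hm.
  exists id, m; split=> // [|k]; first by exists id.
  rewrite -supp_neq0 => kf; apply/andP; split.
    have : (m k * k.1.+1 <= Defs.mdeg m)%N.
      by rewrite /Defs.mdeg (bigD1_seq k) ?fset_uniq //= leq_addr.
    move/leq_trans/(_ hm); apply: leq_trans.
    by rewrite leq_pmull // lt0n -supp_neq0.
  rewrite ltnNge; apply/negP => h; move: hc; rewrite leqn0 => /eqP/eqP.
  by rewrite -[_ == _]negbK -lt0n -has_count => /negP[]; apply/hasP; exists k.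
case: (boolP (has (fun k : nat * nat => N <= k.2)%N (finsupp m))) => [/hasP[k0 k0f k0N]|]; last first.
  by rewrite has_count -leqNgt leqn0 => /eqP e; apply: IH => //; rewrite e.
(* Pigeonhole: if all N places of this row were occupied, then with [k0] the monomial would have N +
   1 variables, and degree above N. *)
have /hasP[j jN jf] : has (fun j => (k0.1, j) \notin finsupp m) (iota 0 N).
  apply: contraT => /hasPn h.
  have : (size (k0 :: [seq (k0.1, j) | j <- iota 0 N]) <= size (finsupp m))%N.
    apply: uniq_leq_size => [|k].
      rewrite /= map_inj_uniq ?iota_uniq ?andbT => [|i j []] //.
      by apply/mapP => -[j]; rewrite mem_iota => /= jN e; move: k0N; rewrite e leqNgt jN.
    by rewrite inE => /predU1P[->//|/mapP[j /h]]; rewrite negbK => jf ->.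
  rewrite /= size_map size_iota => /leq_trans/(_ (size_supp_mdeg m)).
  by move/leq_trans/(_ hm); rewrite ltnn.
move: jN; rewrite mem_iota /= add0n => jN.
pose k1 := (k0.1, j); pose s := swap k0 k1; pose m1 := act_mono s s m.
have e1 k : m1 k = m (s k) by rewrite act_monoE //; apply: swapK.
have rs k : (s k).1 = k.1 by apply: swap_row.
have bs : bijective s by exists s; apply: swapK.
have e1' k : m1 (s k) = m k by rewrite e1 /s swapK.
have nk : k0 != k1.
  by apply: contraTneq k0N => ->; rewrite -ltnNge.
have d1 : Defs.mdeg m1 = Defs.mdeg m by apply: mdeg_act e1'.
have c1 : (count (fun k : nat * nat => N <= k.2)%N (finsupp m1) <= c)%N.
  rewrite -ltnS; apply: leq_trans hc; rewrite -!size_filter.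
  set A := filter _ (finsupp m1); set B := filter _ (finsupp m).
  have : (size (k0 :: A) <= size B)%N; last by [].
  apply: uniq_leq_size => [|k].
    rewrite /= filter_uniq ?fset_uniq ?andbT // mem_filter supp_neq0 e1 /s /swap eqxx.
    by rewrite k0N /= -supp_neq0.
  rewrite inE => /predU1P[->|]; first by rewrite mem_filter k0N.
  rewrite !mem_filter => /andP[kN]; rewrite kN supp_neq0 e1 /s /swap.
  case: (eqVneq k k0) => [_|_]; first by rewrite -supp_neq0 (negbTE jf).
  case: (eqVneq k k1) => [e|_]; last by rewrite -supp_neq0.
  by move: kN; rewrite e leqNgt jN.
have [s' [m' [bs' rs' e' b']]] := IH m1 c1 (leq_trans (eq_leq d1) hm).
exists (s' \o s), m'; split=> // [|k|k] /=; first exact: bij_comp.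
  by rewrite rs' rs.
by rewrite e' e1'.
Qed.

Lemma rep_inj D N f g (p : {mpoly int[N * N]}) : (D <= N)%N ->
  row_invariant f -> row_invariant g -> bnd D f -> bnd D g ->
  rep p f -> rep p g -> f = g.
Proof.
move=> le rf rg bf bg hf hg; apply: functional_extensionality => m.
have [lt|ge] := ltnP D (Defs.mdeg m).
  have z h : bnd D h -> h m = 0.
    by move=> bh; apply/eqP; apply: contraTT lt => /bh; rewrite -leqNgt.
  by rewrite !z.
have [s [m' [bs rs e b]]] := box_move (leq_trans ge le).
rewrite -(rf s bs rs m m' e) -(rg s bs rs m m' e) -(restrK b).
by rewrite -hf -hg.
Qed.

(** * The lambda-structure on PS_Z *)

(** A permutation of the finitely many truncated variables extends by the identity to all of
    them. *)
Lemma rep_row_sym N f (p : {mpoly int[N * N]}) :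
  row_invariant f -> rep p f -> row_sym (fun t => (key t).1) p.
Proof.
move=> hf hp s hs; apply/mpolyP => a; rewrite mcoeff_sym !hp.
pose ext (u : 'S_(N * N)) (k : nat * nat) : nat * nat := if [pick t | key t == k] is Some t then key (u t) else k.
have extE u t : ext u (key t) = key (u t).
  rewrite /ext; case: pickP => [t' /eqP/key_inj -> //|/(_ t)]; by rewrite eqxx.
have ext_out u k : k \notin keys N -> ext u k = k.
  rewrite /ext; case: pickP => // t /eqP <-; by rewrite mem_keys key1 key2.
have extK (u v : 'S_(N * N)) : (forall t, v (u t) = t) -> cancel (ext u) (ext v).
  move=> uv k; case: (boolP (k \in keys N)) => [/mapP[t _ ->]|nk].
    by rewrite !extE uv.
  by rewrite !ext_out.
apply/esym/(hf (ext s)).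
- exists (ext (s^-1)%g); apply: extK => t; [exact: permK | exact: permKV].
- move=> k; case: (boolP (k \in keys N)) => [/mapP[t _ ->]|nk].
    by rewrite extE hs.
  by rewrite ext_out.
move=> k; case: (boolP (k \in keys N)) => [/mapP[t _ ->]|nk].
  by rewrite extE !emb_key mnmE.
by rewrite ext_out // !emb_out.
Qed.

Section Lam.
Implicit Types (f g : mono -> int) (m : mono).

(* Newton's recursion.  That the coefficientwise division by [n] is exact is shown in [rep_lam]. *)
Definition lam_step f n (s : seq (mono -> int)) : mono -> int := fun m =>
  divz ((-1) ^+ n.-1 * \sum_(k < n) (-1) ^+ k * PSmul (nth PSzero s k) (PSpsi (n - k) f) m) n.

Fixpoint lam_seq f n : seq (mono -> int) :=
  if n is n'.+1 then rcons (lam_seq f n') (lam_step f n (lam_seq f n')) else [:: PSone].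

Definition PSlam n f := nth PSzero (lam_seq f n) n.

Lemma size_lam_seq f n : size (lam_seq f n) = n.+1.
Proof. by elim: n => //= n IH; rewrite size_rcons IH. Qed.

Lemma nth_lam_seq f n k : (k <= n)%N -> nth PSzero (lam_seq f n) k = PSlam k f.
Proof.
elim: n => [|n IH]; first by rewrite leqn0 => /eqP->.
rewrite leq_eqVlt => /predU1P[-> //|lt].
by rewrite /= nth_rcons size_lam_seq lt IH.
Qed.

Lemma PSlam0 f : PSlam 0 f = PSone.
Proof. by []. Qed.

Lemma PSlamE f n m : (0 < n)%N -> PSlam n f m =
  divz ((-1) ^+ n.-1 * \sum_(k < n) (-1) ^+ k * PSmul (PSlam k f) (PSpsi (n - k) f) m) n.
Proof.
case: n => // n _; rewrite /PSlam /= nth_rcons size_lam_seq ltnn eqxx.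
rewrite /lam_step; do 2 congr (_ _ _); apply: eq_bigr => k _.
by rewrite nth_lam_seq // -ltnS.
Qed.

Lemma mcoeff_sign K k (p : {mpoly int[K]}) a : ((-1) ^+ k * p)@_a = (-1) ^+ k * p@_a.
Proof. by rewrite -signr_odd -[in RHS]signr_odd; case: odd; rewrite ?mulN1r ?mcoeffN ?mul1r. Qed.

Lemma rep_lam N f (p : {mpoly int[N * N]}) L n :
  rep p f -> is_lam p L -> rep (L n) (PSlam n f).
Proof.
move=> hp [h0 h]; elim/ltn_ind: n => -[|n] IH a.
  by rewrite PSlam0 h0; apply: rep1.
rewrite PSlamE //=; set S := \sum_(k < _) _.
have -> : S = (\sum_(k < n.+1) (-1) ^+ k * (L k * psi (n.+1 - k) p))@_a.
  rewrite raddf_sum; apply: eq_bigr => k _ /=.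
  have <- : (L k * psi (n.+1 - k) p)@_a = PSmul (PSlam k f) (PSpsi (n.+1 - k) f) (emb a).
    by apply: rep_mul; [apply: IH | apply: rep_psi; rewrite ?subn_gt0].
  by rewrite mcoeff_sign.
(* By Newton's equation the signs cancel and the numerator is n + 1 times a coefficient of L_(n+1),
   so the division is exact. *)
rewrite h // mcoeff_sign mcoeffMn mulrA -exprD addnn -mul2n exprM sqrrN !expr1n mul1r.
by rewrite -mulr_natr natz mulzK.
Qed.

(** * Degree bounds and homogeneity, treated together *)

Section Graded.
Variable r : nat -> nat -> Prop.
Hypotheses (r0 : r 0 0) (rD : forall a b c d, r a b -> r c d -> r (a + c)%N (b + d)%N).

(* With [r] equal to [leq] this is boundedness of the degree, with [eq] homogeneity. *)
Definition gr D f := row_invariant f /\ forall m, f m != 0 -> r (Defs.mdeg m) D.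

Lemma gr_zero D : gr D PSzero.
Proof. by split=> // m; rewrite eqxx. Qed.

Lemma gr_one : gr 0 PSone.
Proof.
have z m : (finsupp m == fset0)%fset -> forall k, m k = 0%N.
  by move=> /eqP e k; apply: fsfun_dflt; rewrite e inE.
have z' m : (forall k, m k = 0%N) -> (finsupp m == fset0)%fset.
  by move=> e; apply/eqP/fsetP => k; rewrite supp_neq0 e inE.
split=> [s [t stK tsK] rs m m' e|m].
  rewrite /PSone; congr (nat_of_bool _)%:Z; apply/idP/idP => /z h; apply: z' => k.
    by rewrite -e h.
  by rewrite -[k]tsK e h.
rewrite /PSone; case: (eqVneq (finsupp m) fset0%fset) => [e _|_]; last by rewrite eqxx.
by rewrite /Defs.mdeg e big_nil.
Qed.

Lemma gr_add D f g : gr D f -> gr D g -> gr D (PSadd f g).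
Proof.
move=> [hf df] [hg dg]; split=> [s bs rs m m' e|m].
  by rewrite /PSadd (hf s bs rs m m') // (hg s bs rs m m').
by rewrite /PSadd; case: (eqVneq (f m) 0) => [->|/df //]; rewrite add0r => /dg.
Qed.

Lemma gr_opp D f : gr D f -> gr D (PSopp f).
Proof.
move=> [hf df]; split=> [s bs rs m m' e|m].
  by rewrite /PSopp (hf s bs rs m m').
by rewrite /PSopp oppr_eq0 => /df.
Qed.

Lemma gr_mul D E f g : gr D f -> gr E g -> gr (D + E) (PSmul f g).
Proof.
move=> [hf df] [hg dg]; split=> [|m]; first exact: row_invariant_mul.
by move/PSmul_neq0 => [a [b [/df ra /dg rb ->]]]; apply: rD.
Qed.

Lemma rMn n a D : r a D -> r (n * a)%N (n * D)%N.
Proof. by move=> h; elim: n => [|n IH]; rewrite ?mul0n // !mulSn; apply: rD. Qed.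

Lemma gr_psi n D f : (0 < n)%N -> gr D f -> gr (n * D) (PSpsi n f).
Proof.
move=> n_gt0 [hf df]; split=> [|m]; first exact: row_invariant_psi.
by move/(PSpsi_neq0 n_gt0) => [a [/df ra ->]]; apply: rMn.
Qed.

(** Each term of Newton's recursion has degree k D + (n - k) D, and the division creates no new
    monomials. *)
Lemma gr_lam n D f : gr D f -> gr (n * D) (PSlam n f).
Proof.
move=> hf; elim/ltn_ind: n => -[|n] IH; first exact: gr_one.
have hk (k : 'I_n.+1) : gr (n.+1 * D) (PSmul (PSlam k f) (PSpsi (n.+1 - k) f)).
  have -> : (n.+1 * D = k * D + (n.+1 - k) * D)%N.
    by rewrite -mulnDl subnKC // ltnW.
  by apply: gr_mul; [apply: IH | apply: gr_psi; rewrite ?subn_gt0].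
split=> [s bs rs m m' e|m]; rewrite !PSlamE //.
  do 2 congr (_ _ _); apply: eq_bigr => k _; congr (_ * _).
  exact: ((hk k).1 s bs rs m m').
move=> nz; have /existsP[k] : [exists k : 'I_n.+1, PSmul (PSlam k f) (PSpsi (n.+1 - k) f) m != 0].
  apply: contraNT nz => /existsPn h; rewrite big1 ?mulr0 ?div0z // => k _.
  by have := h k; rewrite negbK => /eqP->; rewrite mulr0.
exact: (hk k).2.
Qed.

End Graded.

Lemma PSP f : PS f <-> exists D, gr leq D f.
Proof.
split=> [[[D hD] hf]|[D [hf hD]]]; [exists D|split=> //; exists D]; first split=> // m.
  by move=> nz; rewrite leqNgt; apply/negP => /hD e; rewrite e eqxx in nz.
by move=> m lt; apply/eqP; apply: contraTT lt => /hD; rewrite -leqNgt.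
Qed.

Lemma PSdegP d f : PSdeg d f <-> gr eq d f.
Proof.
split=> [[[_ hf] h]|[hf h]].
  by split=> // m nz; apply/eqP; apply: contraNT nz => /eqP /h ->.
split=> [|m]; last by move=> ne; apply/eqP; apply: contra_notT ne => /h.
by apply/PSP; exists d; split=> // m /h ->.
Qed.

(* Found by [done] in the side conditions of the [gr_] lemmas below. *)
Let leqD a b c d : (a <= b)%N -> (c <= d)%N -> (a + c <= b + d)%N := @leq_add a c b d.

Lemma PS_zero : PS PSzero.
Proof. by apply/PSP; exists 0%N; apply: gr_zero. Qed.

Lemma PS_one : PS PSone.
Proof. by apply/PSP; exists 0%N; apply: gr_one. Qed.

Lemma grW D E f : (D <= E)%N -> gr leq D f -> gr leq E f.
Proof. by move=> le [h1 h2]; split=> // m /h2 /leq_trans; apply. Qed.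

Lemma PS_add f g : PS f -> PS g -> PS (PSadd f g).
Proof.
move=> /PSP[D hf] /PSP[E hg]; apply/PSP; exists (maxn D E).
by apply: gr_add; [apply: grW hf | apply: grW hg]; rewrite leq_max leqnn ?orbT.
Qed.

Lemma PS_opp f : PS f -> PS (PSopp f).
Proof. by move=> /PSP[D hf]; apply/PSP; exists D; apply: gr_opp. Qed.

Lemma PS_mul f g : PS f -> PS g -> PS (PSmul f g).
Proof.
by move=> /PSP[D hf] /PSP[E hg]; apply/PSP; exists (D + E)%N; apply: gr_mul.
Qed.

Lemma PS_lam n f : PS f -> PS (PSlam n f).
Proof. by move=> /PSP[D hf]; apply/PSP; exists (n * D)%N; apply: gr_lam. Qed.

Lemma PS_rep N f : PS f -> exists p : {mpoly int[N * N]}, rep p f.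
Proof. by move=> /PSP[D [_ hf]]; apply: rep_ex hf. Qed.

Lemma PS_comm_ring : comm_ring_on (A := PSraw) PS.
Proof.
split; first exact: PS_zero.
split; first exact: PS_one.
split; first exact: PS_add.
split; first exact: PS_mul.
split; first exact: PS_opp.
split.
  by move=> x y z _ _ _; apply: functional_extensionality => m; rewrite /= /PSadd addrA.
split.
  by move=> x y _ _; apply: functional_extensionality => m; rewrite /= /PSadd addrC.
split.
  by move=> x _; apply: functional_extensionality => m; rewrite /= /PSadd add0r.
split.
  by move=> x _; apply: functional_extensionality => m; rewrite /= /PSadd /PSopp addNr.
split.
  move=> x y z hx hy hz; apply: rep_det => N.
  have [[[p hp] [q hq]] [s hs]] := (PS_rep N hx, PS_rep N hy, PS_rep N hz).
  exists (p * (q * s)); split; last rewrite mulrA; by repeat apply: rep_mul => //.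
split.
  move=> x y hx hy; apply: rep_det => N.
  have [[p hp] [q hq]] := (PS_rep N hx, PS_rep N hy).
  by exists (p * q); split; last rewrite mulrC; apply: rep_mul.
split.
  move=> x hx; apply: rep_det => N; have [p hp] := PS_rep N hx.
  by exists p; split=> //; rewrite -[p]mul1r; apply: rep_mul => //; apply: rep1.
move=> x y z hx hy hz; apply: rep_det => N.
have [[[p hp] [q hq]] [s hs]] := (PS_rep N hx, PS_rep N hy, PS_rep N hz).
exists (p * (q + s)); split; first by apply: rep_mul => //; apply: rep_add.
by rewrite mulrDr; apply: rep_add; apply: rep_mul.
Qed.

Lemma rep_rsum N (s : seq nat) (p : nat -> {mpoly int[N * N]}) (F : nat -> PSraw) :
  (forall k, k \in s -> rep (p k) (F k)) -> rep (\sum_(k <- s) p k) (rsum s F).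
Proof.
elim: s => [|k s IH] h; first by rewrite big_nil; apply: rep0.
rewrite big_cons; apply: rep_add; first exact/h/mem_head.
by apply: IH => j js; apply: h; rewrite inE js orbT.
Qed.

Lemma rep_rsign N k (p : {mpoly int[N * N]}) f :
  rep p f -> rep ((-1) ^+ k * p) (rsign (A := PSraw) k f).
Proof.
rewrite -signr_odd /rsign => h; case: (odd k); rewrite ?mulN1r ?mul1r //.
exact: rep_opp.
Qed.

Lemma rep_rnatmul N n (p : {mpoly int[N * N]}) f :
  rep p f -> rep (p *+ n) (rnatmul (A := PSraw) n f).
Proof.
move=> h; elim: n => [|n IH]; first exact: rep0.
by rewrite mulrS; apply: rep_add.
Qed.

Lemma PS_lambda_ring : lambda_ring_on (A := PSraw) PS PSlam.
Proof.
split=> //.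
- exact: PS_comm_ring.
- exact: PS_lam.
- move=> f hf; apply: rep_det => N; have [p hp] := PS_rep N hf.
  have [L hL] := is_lam_ex p; exists (L 1%N); split; first exact: rep_lam.
  (* For n = 1 Newton's equation reads psi_1 p = L_1, and psi_1 is the identity. *)
  have [h0 h] := hL; have := h 1%N isT; rewrite big_ord1 h0 !mul1r mulr1n subn0 /= => <-.
  rewrite /psi -[X in rep X _](_ : p = _) // [LHS]mpolyE evalZE.
  apply: eq_bigr => a _; rewrite -/(psi _ _) psiX expr1 mulrzl -scaler_int intz.
  by [].
move=> n f g hf hg; apply: rep_det => N.
have [[p hp] [q hq]] := (PS_rep N hf, PS_rep N hg).
have [[L hL] [L' hL']] := (is_lam_ex p, is_lam_ex q).
exists (conv L L' n); split.
  by apply: rep_lam (rep_add hp hq) (is_lamD hL hL').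
rewrite /conv -(big_mkord xpredT (fun k => L k * L' (n - k)%N)) /index_iota subn0.
apply: rep_rsum => k _.
by apply: rep_mul; [apply: rep_lam hp hL | apply: rep_lam hq hL'].
Qed.

Lemma PS_adams : adams_ops_are (A := PSraw) PS PSlam PSpsi.
Proof.
move=> [//|n] f _ hf; apply: rep_det => N; have [p hp] := PS_rep N hf.
have [L hL] := is_lam_ex p; exists (psi n.+1 p); split; first exact: rep_psi.
(* The term k = 0 of Newton's equation is psi_(n+1) p itself; the other terms go to the right-hand
   side. *)
have [h0 h] := hL; have := h n.+1 isT; rewrite big_ord_recl h0 expr0 !mul1r subn0 /=.
move/(canRL (addrK _)) => ->; apply: rep_add.
  by apply/rep_rsign/rep_rnatmul/rep_lam; eassumption.
apply: rep_opp; rewrite -(big_mkord xpredT (fun k => (-1) ^+ k.+1 * (L k.+1 * psi (n.+1 - k.+1) p))).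
rewrite -(big_add1 _ _ 0 n.+1 xpredT (fun k => (-1) ^+ k * (L k * psi (n.+1 - k) p))) /index_iota subSS subn0.
apply: rep_rsum => k; rewrite mem_iota => /andP[_ lt].
apply: rep_rsign; apply: rep_mul; first by apply: rep_lam; eassumption.
by apply: rep_psi => //; rewrite subn_gt0 -[n.+1]add1n.
Qed.

Lemma rsumE (s : seq nat) (F : nat -> PSraw) (m : mono) :
  rsum s F m = \sum_(k <- s) F k m.
Proof. by elim: s => [|k s IH]; rewrite ?big_nil ?big_cons //= /PSadd IH. Qed.

Lemma rnatmulE n (f : PSraw) (m : mono) : rnatmul n f m = f m *+ n.
Proof. by elim: n => //= n IH; rewrite /PSadd IH mulrS. Qed.

Lemma rsignE k (f : PSraw) (m : mono) : rsign k f m = (-1) ^+ k * f m.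
Proof. by rewrite -signr_odd /rsign; case: odd; rewrite ?mulN1r ?mul1r. Qed.

Lemma eq_rsum (A : rawRing) (s : seq nat) (F G : nat -> A) :
  (forall k, k \in s -> F k = G k) -> rsum s F = rsum s G.
Proof.
elim: s => //= k s IH h; rewrite h ?mem_head // IH // => j js.
by apply: h; rewrite inE js orbT.
Qed.

Lemma PS_lam_uniq (lam : nat -> PSraw -> PSraw) :
  lambda_ring_on (A := PSraw) PS lam -> adams_ops_are (A := PSraw) PS lam PSpsi ->
  forall n f, PS f -> lam n f = PSlam n f.
Proof.
move=> [_ _ l0 _ _] ad n f hf; elim/ltn_ind: n => -[|n] IH; first by rewrite l0.
have := ad n.+1 f isT hf; rewrite (PS_adams (n := n.+1) isT hf).
rewrite (eq_rsum (s := iota 1 n) (G := fun k => rsign k (rmul (lam k f) (PSpsi (n.+1 - k)%N f)))); last first.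
  by move=> k; rewrite mem_iota => /andP[_ lt]; rewrite IH.
move=> e; apply: functional_extensionality => m; have := congr1 (@^~ m) e.
rewrite /= /PSadd => /addIr; rewrite !rsignE !rnatmulE.
move/(mulrI (unitrX n (unitrN1 _))) => h.
by apply/esym; apply: (pmulrnI (ltn0Sn n)); rewrite !mulrS.
Qed.

Lemma PS_graded_ring : graded_ring_on (A := PSraw) PS PSdeg.
Proof.
split; first by move=> d x [].
split; first by move=> d; apply/PSdegP; apply: gr_zero.
split; first by move=> d x y /PSdegP hx /PSdegP hy; apply/PSdegP; apply: gr_add.
split; first by move=> d x /PSdegP hx; apply/PSdegP; apply: gr_opp.
split; first by apply/PSdegP; apply: gr_one.
split.
  move=> d e x y /PSdegP hx /PSdegP hy; apply/PSdegP; apply: gr_mul => //.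
  by move=> a b c k -> ->.
split.
  move=> f /PSP[D [hf bf]].
  exists D.+1, (fun d m => if Defs.mdeg m == d then f m else 0); split=> [d|].
    apply/PSdegP; split=> [s bs rs m m' e|m].
      by rewrite (mdeg_act bs rs e) (hf s bs rs m m' e).
    by case: (eqVneq (Defs.mdeg m) d) => // _; rewrite eqxx.
  apply: functional_extensionality => m; rewrite rsumE.
  case: (leqP (Defs.mdeg m) D) => le.
    rewrite (bigD1_seq (Defs.mdeg m)) ?iota_uniq ?mem_iota //= eqxx big1 ?addr0 // => d.
    by rewrite eq_sym => /negbTE ->.
  have -> : f m = 0 by apply/eqP; apply: contraTT le => /bf; rewrite -leqNgt.
  by rewrite big1 // => d _; case: ifP.
move=> n c hc e d lt; apply: functional_extensionality => m.
have := congr1 (@^~ m) e; rewrite rsumE (bigD1_seq d) ?iota_uniq ?mem_iota //=.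
have [md|/eqP nd] := eqVneq (Defs.mdeg m) d; last by rewrite (hc d).2.
rewrite big1 ?addr0 // => k nk; apply: (hc k).2; rewrite md => /esym/eqP.
exact/negP.
Qed.

Lemma PS_graded_lambda_ring : graded_lambda_ring_on (A := PSraw) PS PSlam PSdeg.
Proof.
split; [exact: PS_lambda_ring | exact: PS_graded_ring |].
move=> n d f /PSdegP hf; apply/PSdegP; apply: gr_lam => //.
by move=> a b c k -> ->.
Qed.

End Lam.

(** * Generation of PS_Z by the elements lambda^n(M_d) *)

Definition is_var (k : nat * nat) (m : mono) := forall k', m k' = (k' == k)%N.

Lemma Md_neq0 i m : Md i.+1 m != 0 -> exists k, k.1 = i /\ is_var k m.
Proof.
rewrite /Md; case: existsP => [[k /and3P[/eqP ek /eqP mk /eqP ki]] _|_]; last by rewrite eqxx.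
exists (val k); split=> // k'; case: (eqVneq k' (val k)) => [->|ne]; first by rewrite mk.
by apply: fsfun_dflt; rewrite ek inE.
Qed.

Lemma Md_var k m : is_var k m -> Md k.1.+1 m = 1.
Proof.
move=> hm; have kf : k \in finsupp m by rewrite supp_neq0 hm eqxx.
rewrite /Md; case: existsP => // -[]; exists [` kf]%fset; rewrite /= hm !eqxx !andbT.
by apply/eqP/fsetP => k'; rewrite supp_neq0 hm inE; case: (k' == k).
Qed.

Lemma Md_cases i m : Md i.+1 m = 0 \/ Md i.+1 m = 1.
Proof. by rewrite /Md; case: [exists _, _]; [right|left]. Qed.

Lemma gr_Md i : gr eq i.+1 (Md i.+1).
Proof.
split=> [s [t stK tsK] rs m m' e|m /Md_neq0[k [ki hm]]]; last first.
  rewrite (mdeg_big (s := [:: k])) => [|//|k']; last first.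
    by rewrite supp_neq0 hm inE; case: (k' == k).
  by rewrite big_seq1 hm eqxx mul1n ki.
(* As [Md] takes only the values 0 and 1, its invariance reduces to that of its support. *)
have h : Md i.+1 m' != 0 <-> Md i.+1 m != 0.
  split=> /Md_neq0[k [ki hm]].
    have -> : Md i.+1 m = 1; last by [].
    rewrite -ki -[k]tsK rs; apply: Md_var => k'.
    by rewrite -e hm -{1}[k]tsK (can_eq stK).
  have -> : Md i.+1 m' = 1; last by [].
  rewrite -ki -rs; apply: Md_var => k'; rewrite -[k' in LHS]tsK e hm.
  by rewrite -(can_eq stK) tsK.
case: (Md_cases i m) (Md_cases i m') h => -> [] -> // [h1 h2].
  by have := h1 isT; rewrite eqxx.
by have := h2 isT; rewrite eqxx.
Qed.

Definition xdeg (s : seq (nat * nat)) := (\sum_(k <- s) k.1.+1 * k.2.+1)%N.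

(* [[:: (c, s); ...]] stands for the sum of the [c * \prod_((i, j) in s) lambda^(j+1)(M_(i+1))]. *)
Definition xexpr := seq (int * seq (nat * nat)).

Definition ev (B : comPzRingType) (g : nat * nat -> B) (x : xexpr) : B :=
  \sum_(t <- x) t.1%:~R * \prod_(k <- t.2) g k.

Definition PSscale (c : int) (f : mono -> int) : mono -> int := fun m => c * f m.

Definition PSgen (k : nat * nat) := PSlam k.2.+1 (Md k.1.+1).

(** An expression has values in three places: in formal sums by [ePS], in truncations by
    [ev (esymN N)], and in R by [ev] at the lambda^n(r_d). Formal sums carry only raw operations,
    whence their own evaluation. *)
Definition ePSmon s := foldr (fun k acc => PSmul (PSgen k) acc) PSone s.

Definition ePS (x : xexpr) :=
  foldr (fun t acc => PSadd (PSscale t.1 (ePSmon t.2)) acc) PSzero x.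

Lemma gr_gen k : gr eq (k.1.+1 * k.2.+1) (PSgen k).
Proof.
rewrite mulnC; apply: gr_lam => [|a b c d -> ->|] //; exact: gr_Md.
Qed.

Lemma gr_ePSmon s : gr eq (xdeg s) (ePSmon s).
Proof.
rewrite /xdeg; elim: s => [|k s IH]; first by rewrite big_nil; apply: gr_one.
rewrite big_cons /=; apply: gr_mul => [a b c d -> ->||] //; exact: gr_gen.
Qed.

Lemma gr_scale r c D f : gr r D f -> gr r D (PSscale c f).
Proof.
move=> [hf df]; split=> [s bs rs m m' e|m].
  by rewrite /PSscale (hf s bs rs m m').
by rewrite /PSscale mulf_eq0 negb_or => /andP[_ /df].
Qed.

Lemma gr_leq D E f : (D <= E)%N -> gr eq D f -> gr leq E f.
Proof. by move=> le [h1 h2]; split=> // m /h2 ->. Qed.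

Lemma gr_ePS D (x : xexpr) : (forall t, t \in x -> (xdeg t.2 <= D)%N) -> gr leq D (ePS x).
Proof.
elim: x => [|t x IH] h /=; first exact: gr_zero.
apply: gr_add.
  by apply/gr_scale/(gr_leq (h t (mem_head _ _)))/gr_ePSmon.
by apply: IH => t' tx; apply: h; rewrite inE tx orbT.
Qed.

Lemma PS_gr_eq d f : gr eq d f -> PS f.
Proof. by move=> h; apply/PSP; exists d; apply: gr_leq h. Qed.

Section Level.
Variable N : nat.

Let row (t : 'I_(N * N)) := (key t).1.
Let rank (t : 'I_(N * N)) := (key t).2.

Lemma key_mono k k' : row k = row k' -> (rank k < rank k')%N = (k < k')%N.
Proof.
rewrite /row /rank /key /= => e; rewrite {2}(divn_eq k N) {2}(divn_eq k' N) e.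
by rewrite ltn_add2l.
Qed.

Lemma key_sat k j : (j < rank k)%N -> exists k', row k' = row k /\ rank k' = j.
Proof.
move=> lj; have /keyP[t et] : (((row k, j).1 < N) && ((row k, j).2 < N))%N.
  by rewrite /= key1 (ltn_trans lj) // key2.
by exists t; rewrite /row /rank et.
Qed.

(** At [key t] this is the [row_esym] of [t]. It is defined for all pairs so that one expression can
    be evaluated at every level N. *)
Definition esymN (k : nat * nat) : {mpoly int[N * N]} :=
  (\prod_(s : 'I_(N * N) | (key s).1 == k.1) (1 + 'X_s *: 'X))`_k.2.+1.

Lemma rep_Md i : rep (\sum_(t : 'I_(N * N) | (key t).1 == i) 'X_t) (Md i.+1).
Proof.
move=> a; rewrite raddf_sum /=.
under eq_bigr => t _ do rewrite mcoeffX.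
case: (boolP [exists t, ((key t).1 == i) && (U_(t)%MM == a)]) => [/existsP[t /andP[/eqP ti /eqP ea]]|no].
  have hv : is_var (key t) (emb a).
    move=> k; case: (boolP (k \in keys N)) => [/mapP[u _ ->]|nk].
      by rewrite emb_key -ea mnm1E (inj_eq (@key_inj N)) eq_sym.
    by rewrite emb_out //; case: eqP nk => // ->; rewrite mem_keys key1 key2.
  rewrite -ti (Md_var hv) (bigD1 t) // ea eqxx big1 => [|u /andP[_ ne]].
    exact: addr0.
  by rewrite -ea eq_mnm1 (negbTE ne).
rewrite big1 => [|t ti]; last first.
  by case: eqP => // e; case/existsP: no; exists t; rewrite ti e eqxx.
apply/esym/eqP; apply: contraNT no => /Md_neq0[k [ki hk]].
have /keyP[t et] : ((k.1 < N) && (k.2 < N))%N.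
  by apply: (@emb_boxed _ a); rewrite hk eqxx.
apply/existsP; exists t; rewrite et ki eqxx; apply/eqP/mnmP => u.
by rewrite mnm1E -emb_key hk -et (inj_eq (@key_inj N)) eq_sym.
Qed.

(** The truncation of M_d is a sum of distinct variables, whose lambda-operations are their
    elementary symmetric polynomials. *)
Lemma rep_gen k : rep (esymN k) (PSgen k).
Proof.
pose us := [seq U_(t)%MM | t <- enum 'I_(N * N) & (key t).1 == k.1].
have := is_lam_gen us.
rewrite big_map big_filter big_enum_cond => /(rep_lam k.2.+1 (rep_Md k.1)).
by rewrite big_map big_filter big_enum_cond.
Qed.

Lemma rep_scale c (p : {mpoly int[N * N]}) f : rep p f -> rep (c%:~R * p) (PSscale c f).
Proof. by move=> h a; rewrite mcoeff_intM h. Qed.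

Lemma rep_ePS x : rep (ev esymN x) (ePS x).
Proof.
elim: x => [|[c s] x IH]; first by rewrite /ev big_nil; apply: rep0.
rewrite /ev big_cons; apply: rep_add IH; apply: rep_scale => /=.
elim: s => [|k s IH] /=; first by rewrite big_nil; apply: rep1.
by rewrite big_cons; apply: rep_mul => //; apply: rep_gen.
Qed.

Definition mseq (a : 'X_{1..N * N}) : seq (nat * nat) :=
  flatten [seq nseq (a t) (key t) | t <- enum 'I_(N * N)].

Lemma prod_mseq (B : comPzRingType) (g : nat * nat -> B) a :
  \prod_(k <- mseq a) g k = \prod_t g (key t) ^+ a t.
Proof.
rewrite /mseq big_flatten big_map big_enum; apply: eq_bigr => t _.
by rewrite big_nseq -Monoid.iteropE.
Qed.

Lemma xdeg_mseq a : xdeg (mseq a) = wt (fun t => kdeg t * (rank t).+1)%N a.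
Proof.
rewrite /xdeg /mseq big_flatten big_map big_enum; apply: eq_bigr => t _.
by rewrite big_nseq iter_addn_0.
Qed.

End Level.

(** Level D is enough: the degree bound passes from [f] to the expression, so both are determined by
    their truncations at D. The clause on [Q] also yields homogeneous expressions for homogeneous
    [f]. *)
Lemma PS_gen D f : gr leq D f -> exists x, ePS x = f /\
  forall Q : nat -> Prop, (forall m, f m != 0 -> Q (Defs.mdeg m)) ->
    forall t, t \in x -> Q (xdeg t.2).
Proof.
move=> hf; have [rf bf] := hf; have [p hp] := rep_ex D bf.
have [F [eF hF]] := row_sym_evalZ_ex (@key_mono D) (@key_sat D) (rep_row_sym rf hp).
pose x : xexpr := [seq (F@_a, mseq a) | a <- msupp F].
have hx (Q : nat -> Prop) : (forall m, f m != 0 -> Q (Defs.mdeg m)) ->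
    forall t, t \in x -> Q (xdeg t.2).
  move=> hQ t /mapP[a aF ->] /=; rewrite xdeg_mseq.
  apply: (hF (@kdeg D) Q) => // [i j|m]; first by rewrite /kdeg => ->.
  by rewrite mcoeff_msupp hp -mdeg_emb; apply: hQ.
exists x; split=> //.
have hxD : gr leq D (ePS x) := gr_ePS (hx (fun d => (d <= D)%N) bf).
have hpx : rep p (ePS x).
  have <- : ev (@esymN D) x = p; last exact: rep_ePS.
  rewrite -eF [RHS]evalZE /ev /x big_map; apply: eq_bigr => a _; congr (_ * _).
  by rewrite prod_mseq evalZXm.
by apply: (@rep_inj D D _ _ p) => //; [exact: hxD.1 | exact: hxD.2].
Qed.

(** * Compatibility with lambda-operations in a special lambda-ring *)

Lemma rsumR (R : comPzRingType) (s : seq nat) (F : nat -> R) :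
  rsum (A := ringRaw R) s F = \sum_(k <- s) F k.
Proof. by elim: s => [|k s IH]; rewrite ?big_nil ?big_cons //= IH. Qed.

Lemma lamD_big (R : comPzRingType) (lam : nat -> R -> R) :
  lambda_ring_on (A := ringRaw R) (fun=> True) lam -> forall n x y,
  lam n (x + y) = \sum_(k < n.+1) lam k x * lam (n - k)%N y.
Proof.
move=> [_ _ _ _ hD] n x y; have := hD n x y I I; rewrite rsumR /= => ->.
by rewrite -(big_mkord xpredT (fun k => lam k x * lam (n - k)%N y)) /index_iota subn0.
Qed.

(** Comparing coefficients in lambda_t(0) = lambda_t(0)^2: once the intermediate terms vanish,
    lambda_(n+1)(0) equals twice itself. *)
Lemma lam_zero (R : comPzRingType) (lam : nat -> R -> R) :
  lambda_ring_on (A := ringRaw R) (fun=> True) lam -> forall n,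
  lam n 0 = (n == 0%N)%:R.
Proof.
move=> hl; have l0 : lam 0%N 0 = 1 by case: hl => _ _ /(_ 0 I).
elim/ltn_ind => -[//|n] IH.
have := lamD_big hl n.+1 0 0; rewrite addr0 big_ord_recl big_ord_recr /= l0.
rewrite subn0 /bump /= add1n subnn l0 mul1r mulr1 big1 => [|k _]; last first.
  by rewrite /bump /= add1n IH ?mul0r // ltnS.
by rewrite add0r -[LHS]addr0 => /addrI <-.
Qed.

Section Universal.
Variables (R : comPzRingType) (lam : nat -> R -> R).
Hypothesis lam_ring : lambda_ring_on (A := ringRaw R) (fun=> True) lam.
Hypothesis lam_special : special lam.

Let lam0 x : lam 0%N x = 1. Proof. by case: lam_ring => _ _ /(_ x I). Qed.
Let lam1 x : lam 1%N x = x. Proof. by case: lam_ring => _ _ _ /(_ x I). Qed.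

Variable r : nat -> R.

Definition Rgen (k : nat * nat) := lam k.2.+1 (r k.1.+1).

Section Level.
Variable N : nat.
Implicit Types (a b : {mpoly int[N * N]}) (x y : R).

(* The graph of the homomorphism [lambda^n(M_d) |-> lambda^n(r_d)] on truncations. *)
Definition graph a x := exists F : {mpoly int[N * N]},
  evalZ (fun t => esymN N (key t)) F = a /\ evalZ (fun t => Rgen (key t)) F = x.

(** Algebraic independence of the elementary symmetric polynomials makes the relation functional. *)
Lemma graph_fun a x y : graph a x -> graph a y -> x = y.
Proof.
move=> [F [eF <-]] [G [eG <-]]; congr (evalZ _ _).
by apply: (evalZ_row_esym_inj (@key_mono N) (@key_sat N)); rewrite [LHS]eF [RHS]eG.
Qed.

(** This lets one universal polynomial be evaluated simultaneously in the truncation and in R. *)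
Lemma graph_evalZ l (P : {mpoly int[l]}) v w :
  (forall i, graph (v i) (w i)) -> graph (evalZ v P) (evalZ w P).
Proof.
move=> h; have [u hu] := fin_all_exists h; exists (evalZ u P).
by rewrite !evalZ_comp; split; apply: eq_evalZ => i; have [] := hu i.
Qed.

Lemma graph0 : graph 0 0.
Proof. by exists 0; rewrite !rmorph0. Qed.

Lemma graph1 : graph 1 1.
Proof. by exists 1; rewrite !rmorph1. Qed.

Lemma graphD a b x y : graph a x -> graph b y -> graph (a + b) (x + y).
Proof. by move=> [F [<- <-]] [G [<- <-]]; exists (F + G); rewrite !rmorphD. Qed.

Lemma graphN a x : graph a x -> graph (- a) (- x).
Proof. by move=> [F [<- <-]]; exists (- F); rewrite !rmorphN. Qed.

Lemma graphM a b x y : graph a x -> graph b y -> graph (a * b) (x * y).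
Proof. by move=> [F [<- <-]] [G [<- <-]]; exists (F * G); rewrite !rmorphM. Qed.

Lemma graph_nat n : graph n%:R n%:R.
Proof. by exists n%:R; rewrite !rmorph_nat. Qed.

Lemma graph_sum n (p : 'I_n -> {mpoly int[N * N]}) (q : 'I_n -> R) :
  (forall k, graph (p k) (q k)) -> graph (\sum_k p k) (\sum_k q k).
Proof.
by move=> h; elim/big_rec2: _ => [|k x y _ IH]; [apply: graph0 | apply: graphD].
Qed.

Lemma graph_key (t : 'I_(N * N)) : graph (esymN N (key t)) (Rgen (key t)).
Proof. by exists 'X_t; rewrite !evalZX. Qed.

Variable n0 : nat.

(** Compatibility with the lambda-operations up to [n0] only: at a fixed level N, the composites of
    high order would involve generators that the truncation does not have. *)
Definition good a x := exists L, is_lam a L /\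
  forall n, (n <= n0)%N -> graph (L n) (lam n x).

Lemma good0 : good 0 0.
Proof.
exists (fun n => (n == 0%N)%:R); split=> [|n _]; first exact: is_lam0.
by rewrite (lam_zero lam_ring); apply: graph_nat.
Qed.

Lemma goodD a b x y : good a x -> good b y -> good (a + b) (x + y).
Proof.
move=> [L [hL gL]] [M [hM gM]]; exists (conv L M); split=> [|n le]; first exact: is_lamD.
rewrite (lamD_big lam_ring); apply: graph_sum => k; apply: graphM.
  by apply: gL; rewrite (leq_trans _ le) // -ltnS.
by apply: gM; rewrite (leq_trans _ le) // leq_subr.
Qed.

(** On both sides lambda_t(-a) is the inverse of lambda_t(a), computed by the same recursion. *)
Lemma goodN a x : good a x -> good (- a) (- x).
Proof.
move=> [L [hL gL]]; have [M hM] := is_lam_ex (- a); exists M; split=> //.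
have L0 := hL.1; have hC := is_lamD hL hM; rewrite subrr in hC.
elim/ltn_ind => n IH le.
have eM : conv L M n = (n == 0%N)%:R := is_lam_uniq hC (@is_lam0 _) n.
have eR := lamD_big lam_ring n x (- x); rewrite subrr (lam_zero lam_ring) in eR.
move: eM eR; rewrite /conv !big_ord_recl L0 lam0 !mul1r subn0.
move/(canRL (addrK _)) => -> /esym/(canRL (addrK _)) ->.
apply: graphD; first exact: graph_nat.
apply/graphN/graph_sum => k; apply: graphM.
  by apply: gL; rewrite (leq_trans _ le) // lift0 ltn_ord.
have n_gt0 : (0 < n)%N by apply: leq_ltn_trans (ltn_ord k).
by apply: IH; rewrite lift0 ?(leq_trans (leq_subr _ _)) // -subn_gt0 subKn // ltn_ord.
Qed.

Lemma goodZ c a x : good a x -> good (c%:~R * a) (c%:~R * x).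
Proof.
move=> h; elim/int_ind: c => [|n IH|n IH]; first by rewrite !mul0r; apply: good0.
  by rewrite intS !rmorphD /= !mulrDl !mul1r; apply: goodD.
rewrite intS opprD !rmorphD /= !mulrDl; apply: goodD IH.
by rewrite !rmorphN1 !mulN1r; apply: goodN.
Qed.

Lemma good1 : good 1 1.
Proof.
have h : is_lam 1 (fun k => (1 + 1 *: 'X : {poly {mpoly int[N * N]}})`_k).
  have := is_lam_gen [:: 0%MM : 'X_{1..N * N}]; rewrite !big_seq1 !mpolyX0.
  exact.
eexists; split; first exact: h.
move=> n _; cbv beta; rewrite coefD coefZ coefX coef1 mul1r.
case: n => [|[|n]] /=; rewrite ?addr0 ?add0r.
- by rewrite lam0; apply: graph1.
- by rewrite lam1; apply: graph1.
by case: lam_special => -> // _ _; apply: graph0.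
Qed.

(** For sums of monomials, repetitions allowed, lambda_t is a product of factors 1 + ut, as the
    identity for P_n requires. *)
Definition eff a := exists us : seq 'X_{1..N * N}, a = \sum_(m <- us) 'X_[m].

Lemma effM a b : eff a -> eff b -> eff (a * b).
Proof.
move=> [us ->] [vs ->]; exists [seq (u + v)%MM | u <- us, v <- vs].
rewrite big_allpairs_dep big_distrl; apply: eq_bigr => u _ /=.
by rewrite big_distrr; apply: eq_bigr => v _; rewrite mpolyXD.
Qed.

(** The roots of lambda_t(ab) are the products of a monomial of [a] and a monomial of [b], so P_n
    computes it from lambda_t(a) and lambda_t(b), as [special] does in R. *)
Lemma goodM a b x y : eff a -> eff b -> good a x -> good b y -> good (a * b) (x * y).
Proof.
move=> [us ea] [vs eb] [L [hL gL]] [M [hM gM]].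
pose ws := [seq (u + v)%MM | u <- us, v <- vs].
have eab : a * b = \sum_(m <- ws) 'X_[m].
  rewrite big_allpairs_dep ea eb big_distrl; apply: eq_bigr => u _ /=.
  by rewrite big_distrr; apply: eq_bigr => v _; rewrite mpolyXD.
eexists; rewrite eab; split; first exact: is_lam_gen.
move=> [|n] le; first by rewrite (is_lam_gen ws).1 lam0; apply: graph1.
(* Room for all the monomials of both factors and for the bound required by [Pn_ex]; missing roots
   are 0. *)
pose N' := maxn n.+1 (maxn (size us) (size vs)).
have [P [isP hP]] := Pn_ex (leq_maxl n.+1 (maxn (size us) (size vs))).
have [_ hm _] := lam_special; rewrite (hm _ P) //.
pose X (i : 'I_N') : {mpoly int[N * N]} := nth 0 [seq 'X_[m] | m <- us] i.
pose Y (i : 'I_N') : {mpoly int[N * N]} := nth 0 [seq 'X_[m] | m <- vs] i.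
have prod_nth (G : {mpoly int[N * N]} -> {poly {mpoly int[N * N]}}) (s : seq 'X_{1..N * N}) :
    G 0 = 1 -> (size s <= N')%N ->
    \prod_(i < N') G (nth 0 [seq 'X_[m] | m <- s] i) = \prod_(m <- s) G 'X_[m].
  move=> G0 les; rewrite -(big_map (fun m => 'X_[m]) xpredT G) (big_nth 0) size_map big_mkord.
  rewrite (big_ord_widen _ (fun i => G (nth 0 [seq 'X_[m] | m <- s] i)) les) [RHS]big_mkcond.
  apply: eq_bigr => i _; case: ltnP => // ge.
  by rewrite nth_default ?size_map.
have les : (size us <= N')%N by rewrite !leq_max leqnn orbT.
have lev : (size vs <= N')%N by rewrite !leq_max leqnn !orbT.
have eL k : (\prod_i (1 + X i *: 'X))`_k = L k.
  rewrite (prod_nth (fun z => 1 + z *: 'X)) // ?scale0r ?addr0 //.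
  by rewrite ea in hL; rewrite (is_lam_uniq hL (is_lam_gen us)).
have eM k : (\prod_i (1 + Y i *: 'X))`_k = M k.
  rewrite (prod_nth (fun z => 1 + z *: 'X)) // ?scale0r ?addr0 //.
  by rewrite eb in hM; rewrite (is_lam_uniq hM (is_lam_gen vs)).
have -> : (\prod_(m <- ws) (1 + 'X_[m] *: 'X))`_n.+1 =
    (\prod_i \prod_j (1 + (X i * Y j) *: 'X))`_n.+1.
  rewrite (prod_nth (fun z => \prod_j (1 + (z * Y j) *: 'X))) //; last first.
    by rewrite big1 // => j _; rewrite mul0r scale0r addr0.
  rewrite /ws big_allpairs_dep; congr ((polyseq _)`_ _); apply: eq_bigr => u _.
  rewrite (prod_nth (fun z => 1 + ('X_[u] * z) *: 'X)) // ?mulr0 ?scale0r ?addr0 //.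
  by apply: eq_bigr => v _; rewrite mpolyXD.
rewrite -hP; apply: graph_evalZ => v; case: (split v) => i.
  by rewrite eL; apply: gL; apply: leq_trans le.
by rewrite eM; apply: gM; apply: leq_trans le.
Qed.

Section Row.
Variable t : 'I_(N * N).
Let i := (key t).1.
Let j := (key t).2.

Lemma tidx_ex (u : 'I_N) : exists s : 'I_(N * N), key s = (i, nat_of_ord u).
Proof. by apply/keyP; rewrite /= ltn_ord key1. Qed.

(** The generator is a sum over the subsets of size j + 1 of its row, so [Pnm_ex] applies. The bound
    on [n0] ensures that the arguments of P_{n,j+1} are themselves generators at level N. *)
Lemma good_key : (n0 * j.+1 <= N)%N ->
  eff (esymN N (key t)) /\ good (esymN N (key t)) (Rgen (key t)).
Proof.
move=> leN; have [f hf] := fin_all_exists tidx_ex.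
pose X u : {mpoly int[N * N]} := 'X_(f u).
have eX k : esymN N (i, k) = (\prod_u (1 + X u *: 'X))`_k.+1.
  rewrite /esymN (reindex_omap f (fun s => insub (key s).2)) => [|s /eqP si].
    congr ((polyseq _)`_ _); apply: eq_bigl => u.
    by rewrite hf eqxx valK eqxx.
  rewrite insubT ?key2 // => h; congr Some.
  apply: key_inj; rewrite hf; move: si => /= <-; exact/esym/surjective_pairing.
pose mS (S : {set 'I_N}) := (\sum_(u in S) U_(f u))%MM.
pose us := [seq mS A | A : {set 'I_N} <- enum {set 'I_N} & #|A| == j.+1].
have XmS S : 'X_[mS S] = \prod_(u in S) X u by rewrite mprodXE.
have ea : esymN N (key t) = \sum_(m <- us) 'X_[m].
  rewrite [key t]surjective_pairing eX -esymfE /esymf big_map big_filter big_enum_cond /=.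
  by apply: eq_bigr => S _; rewrite XmS.
split; first by exists us.
eexists; rewrite ea; split; first exact: is_lam_gen.
move=> [|n] le; first by rewrite (is_lam_gen us).1 lam0; apply: graph1.
have le' : (n.+1 * j.+1 <= N)%N by apply: leq_trans leN; rewrite leq_mul2r le orbT.
have [P [isP hP]] := Pnm_ex le'.
have [_ _ hc] := lam_special; rewrite /Rgen (hc _ _ P) //.
have -> : (\prod_(m <- us) (1 + 'X_[m] *: 'X))`_n.+1 =
    (\prod_(S : {set 'I_N} | #|S| == j.+1) (1 + (\prod_(u in S) X u) *: 'X))`_n.+1.
  rewrite big_map big_filter big_enum_cond /=; congr ((polyseq _)`_ _).
  by apply: eq_bigr => S _; rewrite XmS.
rewrite -hP; apply: graph_evalZ => v; rewrite -eX.
(* The elementary symmetric function of degree v + 1 of the row is the generator in column v, which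
   lies in the box. *)
have vN : (v < N)%N by apply: leq_trans le'.
have := graph_key (f (Ordinal vN)); by rewrite hf.
Qed.

End Row.

Lemma good_ev (x : xexpr) :
  (forall s k, s \in x -> k \in s.2 -> k \in keys N /\ (n0 * k.2.+1 <= N)%N) ->
  good (ev (esymN N) x) (ev Rgen x).
Proof.
elim: x => [|[c s] x IH] h; first by rewrite /ev !big_nil; apply: good0.
rewrite /ev !big_cons; apply: goodD; last first.
  by apply: IH => s' k sx; apply: h; rewrite inE sx orbT.
apply: goodZ => /=; have {}h k : k \in s -> k \in keys N /\ (n0 * k.2.+1 <= N)%N.
  by apply: (h (c, s)); rewrite mem_head.
(* [goodM] needs [eff] of both factors, so it is carried along; the coefficients, possibly negative,
   are left to [goodZ]. *)
suff : eff (\prod_(k <- s) esymN N k) /\ good (\prod_(k <- s) esymN N k) (\prod_(k <- s) Rgen k).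
  by case.
elim: s h => [|k s IHs] h.
  by rewrite !big_nil; split; [exists [:: 0%MM]; rewrite big_seq1 mpolyX0 | apply: good1].
have [|e1 g1] := IHs; first by move=> k' ks; apply: h; rewrite inE ks orbT.
have [/mapP[t _ kt] hk] := h k (mem_head _ _).
have [|e2 g2] := @good_key t; first by rewrite -kt.
by rewrite !big_cons kt; split; [apply: effM | apply: goodM].
Qed.

Lemma graph_ev (x : xexpr) :
  (forall s k, s \in x -> k \in s.2 -> k \in keys N) ->
  graph (ev (esymN N) x) (ev Rgen x).
Proof.
elim: x => [|[c s] x IH] h; first by rewrite /ev !big_nil; apply: graph0.
rewrite /ev !big_cons; apply: graphD; last first.
  by apply: IH => s' k sx; apply: h; rewrite inE sx orbT.
apply: graphM; first by exists c%:~R; rewrite !rmorph_int.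
have {}h k : k \in s -> k \in keys N by apply: (h (c, s)); rewrite mem_head.
elim: s h => /= [|k s IHs] h; first by rewrite !big_nil; apply: graph1.
rewrite !big_cons; apply: graphM.
  by have /mapP[t _ ->] := h k (mem_head _ _); apply: graph_key.
by apply: IHs => k' ks; apply: h; rewrite inE ks orbT.
Qed.

End Level.

End Universal.

(** * The universal property *)

Lemma xexpr_bound (x : xexpr) : exists B, forall s k, s \in x -> k \in s.2 ->
  (k.1 < B)%N && (k.2 < B)%N.
Proof.
pose F (k : nat * nat) := maxn k.1 k.2.
exists (\max_(s <- x) \max_(k <- s.2) F k).+1 => s k sx ks.
rewrite !ltnS -geq_max.
apply: leq_trans (leq_bigmax_seq (F := fun s : int * seq (nat * nat) => \max_(k <- s.2) F k)%N s sx isT).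
exact: (leq_bigmax_seq (F := F) k ks isT).
Qed.

Section Universal.
Variables (R : comPzRingType) (lamR : nat -> R -> R).
Hypothesis lam_ring : lambda_ring_on (A := ringRaw R) (fun=> True) lamR.
Hypothesis lam_special : special lamR.

Section Existence.
Variables (GR : nat -> R -> Prop) (r : nat -> R).
Hypothesis GR_ring : graded_ring_on (A := ringRaw R) (fun=> True) GR.
Hypothesis GR_lam : forall n d x, GR d x -> GR (n * d)%N (lamR n x).
Hypothesis GR_r : forall d, (0 < d)%N -> GR d (r d).

Definition related (f : mono -> int) (y : R) := exists N0, forall N, (N0 <= N)%N ->
  exists p : {mpoly int[N * N]}, rep p f /\ graph lamR r p y.

Lemma related_fun f y z : related f y -> related f z -> y = z.
Proof.
move=> [N0 h] [N1 h'].
have [p [rp gp]] := h _ (leq_maxl N0 N1); have [q [rq gq]] := h' _ (leq_maxr N0 N1).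
by rewrite (rep_fun rp rq) in gp; apply: graph_fun gp gq.
Qed.

Lemma related2 f g h y z w :
  (forall N (p q : {mpoly int[N * N]}), rep p f -> rep q g ->
     graph lamR r p y -> graph lamR r q z ->
     exists s : {mpoly int[N * N]}, rep s h /\ graph lamR r s w) ->
  related f y -> related g z -> related h w.
Proof.
move=> H [N0 h0] [N1 h1]; exists (maxn N0 N1) => N; rewrite geq_max => /andP[le0 le1].
have [[p [rp gp]] [q [rq gq]]] := (h0 N le0, h1 N le1).
exact: H rp rq gp gq.
Qed.

Lemma related_add f g y z : related f y -> related g z -> related (PSadd f g) (y + z).
Proof.
apply: related2 => N p q rp rq gp gq; exists (p + q).
by split; [apply: rep_add | apply: graphD].
Qed.

Lemma related_mul f g y z : related f y -> related g z -> related (PSmul f g) (y * z).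
Proof.
apply: related2 => N p q rp rq gp gq; exists (p * q).
by split; [apply: rep_mul | apply: graphM].
Qed.

Lemma related_one : related PSone 1.
Proof. by exists 0%N => N _; exists 1; split; [apply: rep1 | apply: graph1]. Qed.

Lemma related_ev x : related (ePS x) (ev (Rgen lamR r) x).
Proof.
have [B hB] := xexpr_bound x; exists B => N le; exists (ev (esymN N) x).
split; first exact: rep_ePS.
apply: graph_ev => s k sx ks; have /andP[h1 h2] := hB s k sx ks.
by rewrite mem_keys !(leq_trans _ le).
Qed.

Lemma related_lam n x : related (PSlam n (ePS x)) (lamR n (ev (Rgen lamR r) x)).
Proof.
(* The first bound puts all the generators of [x] in the box, the second is the one that [good_key]
   needs. *)
have [B hB] := xexpr_bound x; exists (maxn B (n * B)) => N.
rewrite geq_max => /andP[leB lenB].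
have [|L [hL gL]] := @good_ev R lamR lam_ring lam_special r N n x.
  move=> s k sx ks; have /andP[h1 h2] := hB s k sx ks.
  rewrite mem_keys (leq_trans h1 leB) (leq_trans h2 leB); split=> //.
  by apply: leq_trans lenB; rewrite leq_mul2l h2 orbT.
exists (L n); split; last exact: gL.
by apply: rep_lam hL; apply: rep_ePS.
Qed.

Lemma GR_natmul d y n : GR d y -> GR d (y *+ n).
Proof.
have [_ [h0 [hD _]]] := GR_ring => hy; elim: n => [|n IH]; first exact: h0.
by rewrite mulrS; apply: hD.
Qed.

Lemma GR_ev d x : (forall t, t \in x -> xdeg t.2 = d) -> GR d (ev (Rgen lamR r) x).
Proof.
have [_ [h0 [hD [hN [h1 [hM _]]]]]] := GR_ring.
elim: x => [|[c s] x IH] h; first by rewrite /ev big_nil; apply: h0.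
rewrite /ev big_cons; apply: hD; last first.
  by apply: IH => t tx; apply: h; rewrite inE tx orbT.
rewrite -(h (c, s) (mem_head _ _)) /=.
have hs : GR (xdeg s) (\prod_(k <- s) Rgen lamR r k).
  rewrite /xdeg; elim: s {h} => [|k s IHs]; first by rewrite !big_nil; apply: h1.
  rewrite !big_cons; apply: hM IHs; rewrite mulnC; apply: GR_lam; exact: GR_r.
by case: c {h} => n; rewrite mulrzl ?NegzE ?mulrNz; [|apply: hN]; apply: GR_natmul.
Qed.

Lemma universal_hom : exists phi : (mono -> int) -> R,
  graded_lambda_hom PSlam lamR GR phi /\ forall d, (0 < d)%N -> phi (Md d) = r d.
Proof.
(* Any expression for [f] will do, since [related_fun] makes the value independent of it; outside
   PS_Z the value is 0. *)
have ex f : exists y, PS f -> exists x, ePS x = f /\ y = ev (Rgen lamR r) x.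
  case: (classic (PS f)) => [hf|nf]; last by exists 0.
  have /PSP[D hD] := hf; have [x [ex _]] := PS_gen hD.
  by exists (ev (Rgen lamR r) x) => _; exists x.
pose phi f := proj1_sig (constructive_indefinite_description _ (ex f)).
have hphi f : PS f -> exists x, ePS x = f /\ phi f = ev (Rgen lamR r) x.
  exact: proj2_sig (constructive_indefinite_description _ (ex f)).
exists phi; move: phi hphi => phi hphi.
have rel f : PS f -> related f (phi f).
  by move/hphi => [x [<- ->]]; apply: related_ev.
split; [split|].
- move=> f g hf hg; apply: related_fun (rel _ (PS_add hf hg)) _.
  by apply: related_add; apply: rel.
- move=> f g hf hg; apply: related_fun (rel _ (PS_mul hf hg)) _.
  by apply: related_mul; apply: rel.
- exact: related_fun (rel _ PS_one) related_one.
- move=> n f hf; apply: related_fun (rel _ (PS_lam n hf)) _.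
  have [x [ef ->]] := hphi f hf; rewrite -{1}ef; exact: related_lam.
- move=> d f hf; have /PSdegP hd := hf; have hf' := PS_gr_eq hd.
  (* The expression behind [phi f] says nothing about degrees; another one, with all terms of degree
     d, has the same value. *)
  have [x [ef hx]] := PS_gen (gr_leq (leqnn d) hd).
  have -> : phi f = ev (Rgen lamR r) x.
    by apply: related_fun (rel f hf') _; rewrite -ef; apply: related_ev.
  by apply: GR_ev => t tx; apply: (hx (fun e => e = d)) => // m; apply: hd.2.
move=> [//|d] _; have hd := PS_gr_eq (gr_Md d).
have [_ _ _ l1 _] := PS_lambda_ring; have [_ _ _ r1 _] := lam_ring.
apply: related_fun (rel _ hd) _.
(* M_(d+1) is lambda^1 of itself, hence a single generator, in column 0. *)
have eMd : ePS [:: (1, [:: (d, 0%N)])] = Md d.+1.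
  have [cr _ _ _ _] := PS_lambda_ring.
  move: cr => [_ [_ [_ [_ [_ [_ [_ [_ [_ [_ [mC [m1 _]]]]]]]]]]]].
  apply: functional_extensionality => m.
  rewrite /ePS /= /ePSmon /= /PSgen /= l1 // /PSadd /PSscale addr0 mul1r.
  by rewrite [PSmul _ _](mC _ _ hd PS_one) [rmul _ _](m1 _ hd).
have := related_ev [:: (1, [:: (d, 0%N)])].
by rewrite eMd /ev big_seq1 /= big_seq1 mul1r /Rgen /= r1.
Qed.

End Existence.

Section Uniqueness.
Variables (GR : nat -> R -> Prop) (phi : (mono -> int) -> R).
Hypothesis phi_hom : graded_lambda_hom PSlam lamR GR phi.

Lemma hom_zero : phi PSzero = 0.
Proof.
have [hD _ _ _ _] := phi_hom; have := hD _ _ PS_zero PS_zero.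
have -> : PSadd PSzero PSzero = PSzero.
  by apply: functional_extensionality => m; rewrite /PSadd addr0.
by rewrite -[LHS]addr0 => /addrI.
Qed.

Lemma hom_scale c f : PS f -> phi (PSscale c f) = c%:~R * phi f.
Proof.
move=> hf; have [hD _ _ _ _] := phi_hom.
have hS n : PS (PSscale n f).
  by have /PSP[D h] := hf; apply/PSP; exists D; apply: gr_scale.
have e0 : PSscale 0 f = PSzero.
  by apply: functional_extensionality => m; rewrite /PSscale mul0r.
have eD a b : phi (PSscale (a + b) f) = phi (PSscale a f) + phi (PSscale b f).
  rewrite -hD //; congr phi; apply: functional_extensionality => m.
  by rewrite /PSadd /PSscale mulrDl.
have e1 : phi (PSscale 1 f) = phi f.
  by congr phi; apply: functional_extensionality => m; rewrite /PSscale mul1r.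
elim/int_ind: c => [|n IH|n IH].
- by rewrite e0 hom_zero mul0r.
- by rewrite intS eD e1 IH rmorphD /= mulrDl mul1r.
rewrite intS opprD eD IH rmorphD /= mulrDl; congr (_ + _).
apply: (addrI (phi f)); rewrite -{1}e1 -eD subrr e0 hom_zero.
by rewrite mulrN1z mulN1r subrr.
Qed.

(** This gives injectivity: the values at the M_d fix [phi] on every expression, hence by [PS_gen]
    on PS_Z. *)
Lemma hom_ev x : phi (ePS x) = ev (Rgen lamR (fun d => phi (Md d))) x.
Proof.
have [hD hM h1 hl _] := phi_hom.
have PSg k : PS (PSgen k) := PS_gr_eq (gr_gen k).
have PSm s : PS (ePSmon s) := PS_gr_eq (gr_ePSmon s).
have em s : phi (ePSmon s) = \prod_(k <- s) Rgen lamR (fun d => phi (Md d)) k.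
  elim: s => [|k s IH]; first by rewrite big_nil.
  rewrite big_cons /= hM // IH; congr (_ * _); apply: hl.
  exact: PS_gr_eq (gr_Md k.1).
elim: x => [|[c s] x IH]; first by rewrite /ev big_nil; apply: hom_zero.
rewrite /ev big_cons /= hD ?IH ?hom_scale ?em //.
  by have /PSP[D h] := PSm s; apply/PSP; exists D; apply: gr_scale.
apply/PSP; exists (\max_(t <- x) xdeg t.2); apply: gr_ePS => t tx.
exact: (leq_bigmax_seq (F := fun t : int * seq (nat * nat) => xdeg t.2) t tx isT).
Qed.

End Uniqueness.

End Universal.

Lemma ev_eq (B : comPzRingType) (g h : nat * nat -> B) x : g =1 h -> ev g x = ev h x.
Proof.
move=> e; apply: eq_bigr => t _; congr (_ * _); apply: eq_bigr => k _; exact: e.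
Qed.

Theorem theorem2 :
  exists lam : nat -> PSraw -> PSraw,
    (* PS_Z with lam and the degree grading is a graded lambda-ring ... *)
    graded_lambda_ring_on (A := PSraw) PS lam PSdeg /\
    (* ... whose Adams operations are psi_n(g)(x) = g(x^n) ... *)
    adams_ops_are (A := PSraw) PS lam PSpsi /\
    (* ... and lam is the unique lambda-ring structure with these Adams ops *)
    (forall lam' : nat -> PSraw -> PSraw,
       lambda_ring_on (A := PSraw) PS lam' -> adams_ops_are (A := PSraw) PS lam' PSpsi ->
       forall n f, PS f -> lam' n f = lam n f) /\
    (* universal property w.r.t. special graded lambda-rings *)
    (forall (R : comPzRingType) (lamR : nat -> R -> R) (GR : nat -> R -> Prop),
       graded_lambda_ring_on (A := ringRaw R) (fun _ => True) lamR GR ->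
       special lamR ->
       (* surjectivity of phi |-> (phi(M_d))_{d>=1} onto prod_{d>=1} R_d *)
       (forall r : nat -> R, (forall d, (0 < d)%N -> GR d (r d)) ->
          exists phi : (mono -> int) -> R,
            graded_lambda_hom lam lamR GR phi /\
            forall d, (0 < d)%N -> phi (Md d) = r d) /\
       (* injectivity *)
       (forall phi phi' : (mono -> int) -> R,
          graded_lambda_hom lam lamR GR phi ->
          graded_lambda_hom lam lamR GR phi' ->
          (forall d, (0 < d)%N -> phi (Md d) = phi' (Md d)) ->
          forall f, PS f -> phi f = phi' f)).
Proof.
exists PSlam; split; first exact: PS_graded_lambda_ring.
split; first exact: PS_adams.
split; first exact: PS_lam_uniq.
move=> R lamR GR [lring gring glam] spec; split=> [r hr|phi phi' hphi hphi' e f].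
  exact: universal_hom.
move=> /PSP[D hD]; have [x [<- _]] := PS_gen hD.
rewrite (hom_ev hphi) (hom_ev hphi'); apply: ev_eq => k.
by rewrite /Rgen e.
Qed.
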